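(* Let $G=(V,E)$ be a finite, simple, undirected, connected graph with $n=|V|$ vertices and $m=|E|$ edges, such that the maximum degree satisfies $\Delta(G)=n-4$ and $m\geq 7n$. Then $G$ is antimagic.
   Context: An antimagic labelling of a graph $G=(V,E)$ with $m$ edges is a bijection $f:E\to\{1,2,\ldots,m\}$ such that the vertex-sums $\sigma(u)=\sum_{v:\,uv\in E} f(uv)$, $u\in V$, are pairwise distinct. A graph is antimagic if it admits an antimagic labelling. $\Delta(G)$ denotes the maximum vertex degree of $G$. *)

(* Defs.v *)
From mathcomp Require Import all_boot.

Set Implicit Arguments.
Unset Strict Implicit.
Unset Printing Implicit Defensive.

(* A finite simple undirected graph is given by its vertex type [T : finType]
   and its adjacency relation [e : rel T], assumed symmetric and irreflexive. *)

Definition edges (T : finType) (e : rel T) : {set {set T}} :=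
  [set [set p.1; p.2] | p : T * T & e p.1 p.2].

Definition degree (T : finType) (e : rel T) (u : T) : nat := #|[set v | e u v]|.

Definition max_degree (T : finType) (e : rel T) : nat := \max_(u : T) degree e u.

Definition connected_graph (T : finType) (e : rel T) : Prop :=
  forall u v : T, connect e u v.

(* [f] is defined on all sets of vertices, but only its values on edges matter:
   it restricts to a bijection from the edges onto {1, ..., m}. *)
Definition edge_labelling (T : finType) (e : rel T) (f : {set T} -> nat) : Prop :=
  [/\ {in edges e, forall a, 1 <= f a <= #|edges e|},
      {in edges e &, injective f}
    & forall k, 1 <= k <= #|edges e| -> exists2 a, a \in edges e & f a = k].

Definition vertex_sum (T : finType) (e : rel T) (f : {set T} -> nat) (u : T) : nat :=
  \sum_(v : T | e u v) f [set u; v].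

Definition antimagic (T : finType) (e : rel T) : Prop :=
  exists f : {set T} -> nat, edge_labelling e f /\ injective (vertex_sum e f).

(* Main.v *)
(* Let x be a vertex of degree k = n - 4, let N be its neighbourhood, Y the other three
   vertices, and M >= 6k + 28 the number of edges avoiding x. These edges get the labels 1,
   ..., M and the edges at x the labels M + 1, ..., M + k, so that x has the largest sum. If
   N is sorted by its partial sums and receives the star labels in increasing order, the
   sums on N are distinct; the difficulty is a vertex of Y whose sum coincides with one of
   them.
      Let P consist of three vertices of N of largest degree away from x. If every p in P
   has a partial sum exceeding those on N \ P by at least k, then the star labels used on P
   are irrelevant for N \ P. So k = |N \ P| + 3 labels are available for N \ P, and each of
   the three values to be avoided is dodged by skipping one label.
      The edges avoiding x are labelled so that P dominates (edges at P get the top labels,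
   every other vertex of N has an edge with a small label or small degree), the three sums
   on Y are distinct, and no sum on Y can be reached by a vertex of P. The last two
   properties are obtained by correcting the vertices of Y one at a time, exchanging the
   label of one edge at y with that of a spare edge not meeting Y. *)

Require Import Defs.
From mathcomp Require Import all_boot.
From mathcomp Require Import perm zify.

Set Implicit Arguments.
Unset Strict Implicit.
Unset Printing Implicit Defensive.

(* Greedy: offer the largest remaining label to the vertex of largest weight, and drop the
   label if it produces a value of Z. All later sums are strictly smaller, so each value of
   Z costs at most one label. *)
Lemma distinct_sum_assignment (T : finType) (w : T -> nat) (A : {set T})
    (Z O : seq nat) :
  uniq O -> size Z + #|A| <= size O ->
  exists L : T -> nat,
    [/\ {in A, forall v, L v \in O}, {in A &, injective L},
        {in A &, injective (fun v => w v + L v)}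
      & {in A, forall v, w v + L v \notin Z}].
Proof.
elim: {O}(size O) {-2}O (erefl (size O)) A Z => [|k IHk] O szO A Z uniqO.
  rewrite szO leqn0 addn_eq0 cards_eq0 => /andP[_ /eqP->].
  by exists (fun=> 0); split=> v; rewrite ?inE.
have [->|[v0 v0A]] := set_0Vmem A => leZA.
  by exists (fun=> 0); split=> v; rewrite ?inE.
have [K KO maxK] : exists2 K, K \in O & forall l, l \in O -> l <= K.
  have O0 : head 0 O \in O by case: (O) szO => //= a s _; rewrite mem_head.
  have bO : forall l, l \in O -> l <= \max_(i <- O) i.
    by move=> l lO; rewrite (big_rem l) //= leq_maxl.
  by case: (ex_maxnP (ex_intro (fun l => l \in O) _ O0) bO) => K KO HK; exists K.
have remO l : l \in rem K O -> l \in O /\ l < K.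
  rewrite mem_rem_uniq // inE => /andP[lK lO].
  by split=> //; rewrite ltn_neqAle lK maxK.
have szrem : size (rem K O) = k by rewrite size_rem // szO.
case: (arg_maxnP w v0A) => v; move=> vA maxv; have {}vA : v \in A := vA; have {}maxv u : u \in A -> w u <= w v := maxv u.
have [KZ|KZ] := boolP (w v + K \in Z).
  have [|L [LO Linj sinj LZ]] := IHk _ szrem A (rem (w v + K) Z) (rem_uniq _ uniqO).
    by rewrite szrem size_rem // -ltnS -szO (leq_trans _ leZA) // -addSn prednK //; case: (Z) KZ.
  exists L; split=> // u uA; first by have [] := remO _ (LO u uA).
  have [_ lt_LK] := remO _ (LO u uA).
  have lt_s : w u + L u < w v + K by rewrite -addnS leq_add // maxv.
  apply: contra (LZ u uA) => uZ.
  have := perm_mem (perm_to_rem KZ) (w u + L u).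
  by rewrite uZ inE ltn_eqF //= => /esym.
have [|L [LO Linj sinj LZ]] := IHk _ szrem (A :\ v) Z (rem_uniq _ uniqO).
  by rewrite szrem -ltnS -szO -addnS; move: leZA; rewrite (cardsD1 v A) vA.
pose L' u := if u == v then K else L u.
have L'v : L' v = K by rewrite /L' eqxx.
have L'E u : u \in A -> u != v -> [/\ L' u = L u, L u \in O, L u < K & u \in A :\ v].
  move=> uA uv; have uAv : u \in A :\ v by rewrite !inE uv.
  by have [? ?] := remO _ (LO u uAv); rewrite /L' (negbTE uv).
have lt_s u : u \in A -> u != v -> w u + L' u < w v + K.
  by move=> uA uv; have [-> _ ltL _] := L'E u uA uv; rewrite -addnS leq_add // maxv.
exists L'; split.
- by move=> u uA; have [->|uv] := eqVneq u v; [rewrite L'v | have [-> ? _ _] := L'E u uA uv].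
- move=> u1 u2 u1A u2A.
  have [->|n1] := eqVneq u1 v; have [->|n2] := eqVneq u2 v; rewrite ?L'v //.
  + by have [-> _ ltL _] := L'E u2 u2A n2 => eqL; rewrite eqL ltnn in ltL.
  + by have [-> _ ltL _] := L'E u1 u1A n1 => eqL; rewrite eqL ltnn in ltL.
  + by have [-> _ _ ?] := L'E u1 u1A n1; have [-> _ _ ?] := L'E u2 u2A n2; apply: Linj.
- move=> u1 u2 u1A u2A /=.
  have [->|n1] := eqVneq u1 v; have [->|n2] := eqVneq u2 v; rewrite ?L'v //.
  + by move=> eqs; move: (lt_s u2 u2A n2); rewrite -eqs ltnn.
  + by move=> eqs; move: (lt_s u1 u1A n1); rewrite eqs ltnn.
  + by have [-> _ _ ?] := L'E u1 u1A n1; have [-> _ _ ?] := L'E u2 u2A n2; apply: sinj.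
- move=> u uA; have [->|uv] := eqVneq u v; first by rewrite L'v.
  by have [-> _ _ ?] := L'E u uA uv; apply: LZ.
Qed.

(** * Counting with injective labels and extending them *)

Lemma card_labels_le (T : finType) (S : {set T}) (f : T -> nat) (s : seq nat) :
  {in S &, injective f} -> {in S, forall a, f a \in s} -> #|S| <= size s.
Proof.
move=> finj fs; rewrite cardE -(size_map f); apply: uniq_leq_size.
  by rewrite map_inj_in_uniq ?enum_uniq // => a b; rewrite !mem_enum; apply: finj.
by move=> l /mapP[a]; rewrite mem_enum => aS ->; apply: fs.
Qed.

(** The extreme case is [c + 1], ..., [c + #|S|]; both sides are doubled to avoid halving a
    product. *)
Lemma sum_distinct_ge (T : finType) (S : {set T}) (f : T -> nat) (c : nat) :
  {in S &, injective f} -> {in S, forall a, c < f a} ->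
  #|S| * c.*2 + #|S| * #|S|.+1 <= (\sum_(a in S) f a).*2.
Proof.
elim: {S}#|S| {-2}S (erefl #|S|) => [|k IHk] S cardS finj fgt.
  by rewrite cardS.
have [a0 a0S] : exists a, a \in S by apply/set0Pn; rewrite -card_gt0 cardS.
case: (arg_maxnP f a0S) => a aS maxa; have {}aS : a \in S := aS; have {}maxa b : b \in S -> f b <= f a := maxa b.
have cSa : #|S :\ a| = k by apply/eqP; rewrite -eqSS -cardS (cardsD1 a S) aS.
have sub : {subset S :\ a <= S} by move=> b /setD1P[].
have := IHk _ cSa (sub_in2 sub finj) (sub_in1 sub fgt).
rewrite (big_setD1 a aS) /= cSa cardS.
(* All [k + 1] distinct values lie between [c + 1] and the maximum [f a]. *)
suff : c + k.+1 <= f a by lia.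
have := @card_labels_le _ S f (iota c.+1 (f a - c)) finj.
rewrite size_iota cardS => H; have := fgt _ aS.
suff : k < f a - c by lia.
by apply: H => b bS; rewrite mem_iota; have := fgt _ bS; have := maxa _ bS; lia.
Qed.

Lemma injection_extend (T : finType) (S S' : {set T}) (f : T -> nat) (O : seq nat) :
  {in S &, injective f} -> [disjoint S & S'] -> uniq O -> #|S'| <= size O ->
  {in S, forall a, f a \notin O} ->
  exists f' : T -> nat,
    [/\ {in S, f' =1 f}, {in S', forall a, f' a \in O}
      & {in S :|: S' &, injective f'}].
Proof.
move=> finj dis uniqO leO fO.
pose h a := nth 0 O (index a (enum S')).
have idx a : a \in S' -> index a (enum S') < size O.
  by move=> aS; rewrite (leq_trans _ leO) // cardE index_mem mem_enum.
have hO a : a \in S' -> h a \in O by move=> aS; rewrite mem_nth ?idx.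
have nS a : a \in S' -> (a \in S) = false by move=> aS; rewrite (disjointFl dis).
exists (fun a => if a \in S then f a else h a); split.
- by move=> a aS; rewrite aS.
- by move=> a aS; rewrite nS // hO.
- move=> a b /setUP[] aS /setUP[] bS; rewrite /= ?aS ?bS.
  + exact: finj.
  + by rewrite nS // => eqf; have := fO _ aS; rewrite eqf hO.
  + by rewrite nS // => eqf; have := fO _ bS; rewrite -eqf hO.
  + rewrite !nS // => /eqP; rewrite nth_uniq ?idx // => /eqP eqi.
    by apply: (index_inj a _ _ eqi); rewrite mem_enum.
Qed.

(** * Edge sums *)

Definition incident (T : finType) (E : {set {set T}}) (u : T) : {set {set T}} :=
  [set a in E | u \in a].

(** Summing over edges instead of neighbours allows [E] to be the set of edges avoiding x, and turns
    an exchange of labels into composition with a transposition of edges. *)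
Definition edge_sum (T : finType) (E : {set {set T}}) (f : {set T} -> nat) (u : T) : nat :=
  \sum_(a in incident E u) f a.

Lemma mem_edges (T : finType) (e : rel T) u v : e u v -> [set u; v] \in edges e.
Proof. by move=> euv; apply/imsetP; exists (u, v); rewrite ?inE. Qed.

Lemma incident_edgesP (T : finType) (e : rel T) u a :
  symmetric e ->
  reflect (exists2 v, e u v & a = [set u; v]) (a \in incident (edges e) u).
Proof.
move=> e_sym; rewrite inE; apply: (iffP andP) => [[]|[v euv ->]].
  case/imsetP=> -[p q]; rewrite inE /= => epq ->.
  case/set2P=> ->; first by exists q.
  by exists p; rewrite 1?e_sym 1?setUC.
by rewrite mem_edges // set21.
Qed.

Lemma card_mem_edges (T : finType) (e : rel T) a :
  irreflexive e -> a \in edges e -> #|a| = 2.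
Proof.
move=> e_irr /imsetP[[p q]]; rewrite inE /= => epq ->.
by rewrite cards2; case: eqVneq epq => // ->; rewrite e_irr.
Qed.

Lemma set2_inj (T : finType) (u v v' : T) :
  v != u -> [set u; v] = [set u; v'] -> v = v'.
Proof.
move=> vu eqa; have: v \in [set u; v'] by rewrite -eqa set22.
by rewrite !inE (negbTE vu) => /eqP.
Qed.

Lemma incident_edges (T : finType) (e : rel T) u :
  symmetric e -> incident (edges e) u = [set [set u; v] | v in [set v | e u v]].
Proof.
move=> e_sym; apply/setP=> a; apply/(incident_edgesP _ _ e_sym)/imsetP.
  by case=> v euv ->; exists v; rewrite ?inE.
by case=> v; rewrite inE => euv ->; exists v.
Qed.

Lemma neighbour_edge_inj (T : finType) (e : rel T) u :
  irreflexive e -> {in [set v | e u v] &, injective (fun v => [set u; v])}.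
Proof.
move=> e_irr v v'; rewrite !inE => euv _; apply: set2_inj.
by apply: contraTneq euv => ->; rewrite e_irr.
Qed.

Lemma vertex_sumE (T : finType) (e : rel T) f u :
  symmetric e -> irreflexive e -> vertex_sum e f u = edge_sum (edges e) f u.
Proof.
move=> e_sym e_irr; rewrite /edge_sum incident_edges // big_imset /=.
  by apply: eq_bigl => v; rewrite inE.
exact: neighbour_edge_inj.
Qed.

Lemma degreeE (T : finType) (e : rel T) u :
  symmetric e -> irreflexive e -> degree e u = #|incident (edges e) u|.
Proof.
by move=> e_sym e_irr; rewrite incident_edges // card_in_imset //; apply: neighbour_edge_inj.
Qed.

(** Handshake identity, by double counting of the pairs (vertex, edge). *)
Lemma sum_card_incident (T : finType) (E : {set {set T}}) :
  {in E, forall a : {set T}, #|a| = 2} -> \sum_u #|incident E u| = 2 * #|E|.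
Proof.
move=> E2; transitivity (\sum_(u : T) \sum_(a in E) (u \in a : nat)).
  apply: eq_bigr => u _; rewrite -sum1_card -big_mkcondr /=.
  by apply: eq_bigl => a; rewrite inE.
rewrite exchange_big /= mulnC -sum_nat_const; apply: eq_bigr => a aE.
by rewrite -(E2 a aE) -sum1_card [RHS]big_mkcond.
Qed.

Lemma connected_exit (T : finType) (e : rel T) (S : {set T}) u v :
  connected_graph e -> u \in S -> v \notin S ->
  exists s t, [/\ s \in S, t \notin S & e s t].
Proof.
move=> e_conn uS; case/connectP: (e_conn u v) => p.
elim: p u uS => [|t p IHp] u uS /=; first by move=> _ ->; rewrite uS.
case/andP=> eut path_p last_p vS; have [tS|tS] := boolP (t \in S).
  exact: (IHp t).
by exists u, t.
Qed.

(** Surjectivity follows by counting. *)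
Lemma injective_edge_labelling (T : finType) (e : rel T) f :
  {in edges e, forall a, 1 <= f a <= #|edges e|} ->
  {in edges e &, injective f} -> edge_labelling e f.
Proof.
move=> fb finj; split=> // k kb.
have /(_ k) : [seq f a | a <- enum (edges e)] =i iota 1 #|edges e|.
  apply: (uniq_min_size _ _ _).2.
  - by rewrite map_inj_in_uniq ?enum_uniq // => a b; rewrite !mem_enum; apply: finj.
  - move=> l /mapP[a]; rewrite mem_enum => /fb fab ->; rewrite mem_iota; lia.
  - by rewrite size_map -cardE size_iota.
rewrite mem_iota add1n ltnS kb => /mapP[a]; rewrite mem_enum => aE ->.
by exists a.
Qed.

(** * Exchanging two labels *)

Section Swap.
Variables (T : finType) (E : {set {set T}}) (f : {set T} -> nat) (g c : {set T}).
Hypotheses (gE : g \in E) (cE : c \in E).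

Lemma mem_tperm (U : finType) (S : {set U}) (s t a : U) :
  (s \in S) = (t \in S) -> (tperm s t a \in S) = (a \in S).
Proof. by move=> st; case: tpermP => [->|->|]. Qed.

Lemma edge_sum_tperm u :
  (u \in g) = (u \in c) -> edge_sum E (f \o tperm g c) u = edge_sum E f u.
Proof.
move=> gc; rewrite /edge_sum [RHS](reindex_inj (@perm_inj _ (tperm g c))) /=.
by apply: eq_bigl => a; rewrite mem_tperm // !inE gE cE.
Qed.

(** The additive form avoids truncated subtraction. *)
Lemma edge_sum_tperm1 u :
  u \in g -> u \notin c ->
  edge_sum E (f \o tperm g c) u + f g = edge_sum E f u + f c.
Proof.
move=> ug uc; have gI : g \in incident E u by rewrite inE gE.
rewrite /edge_sum !(big_setD1 g gI) /= tpermL.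
suff -> : \sum_(a in incident E u :\ g) f (tperm g c a) =
          \sum_(a in incident E u :\ g) f a.
  by rewrite -addnA addnC; congr (_ + _); apply: addnC.
apply: eq_bigr => a; rewrite !inE => /and3P[ag _ ua].
by rewrite tpermD // eq_sym //; apply: contraNneq uc => <-.
Qed.

Lemma tperm_injective : {in E &, injective f} -> {in E &, injective (f \o tperm g c)}.
Proof.
have memE a : (tperm g c a \in E) = (a \in E) by rewrite mem_tperm // gE cE.
by move=> finj a b aE bE /= /finj eqp; apply: (@perm_inj _ (tperm g c)); rewrite eqp ?memE.
Qed.
End Swap.

Lemma edge_sum_le (T : finType) (E : {set {set T}}) f u c :
  {in E, forall a : {set T}, f a <= c} -> edge_sum E f u <= #|incident E u| * c.
Proof.
move=> fc; rewrite -sum_nat_const; apply: leq_sum => a; rewrite inE => /andP[aE _].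
exact: fc.
Qed.

(** * Completing a labelling at the vertex x *)

Section Star.
Variables (T : finType) (e : rel T).
Hypotheses (e_sym : symmetric e) (e_irr : irreflexive e).
Variable x : T.

Definition nbhd : {set T} := [set v | e x v].
Definition off_edges : {set {set T}} := [set a in edges e | x \notin a].

Lemma x_notin_nbhd : x \notin nbhd. Proof. by rewrite inE e_irr. Qed.

Lemma incident_off_edges u : u \in nbhd ->
  incident (edges e) u = [set x; u] |: incident off_edges u
  /\ [set x; u] \notin incident off_edges u.
Proof.
rewrite inE => exu; split; last by rewrite !inE eqxx andbF.
apply/setP=> a; rewrite !inE; have [->|ne_a] := eqVneq a [set x; u].
  by rewrite mem_edges // set22.
rewrite /= -andbA; have [xa|] //= := boolP (x \in a).
rewrite andbF; apply/negP=> aE; have : a \in incident (edges e) x by case/andP: aE => aE _; rewrite inE aE.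
case/(incident_edgesP _ _ e_sym) => v exv av; case/andP: aE => _.
rewrite av !inE => /orP[] /eqP eu; first by rewrite eu e_irr in exu.
by rewrite av eu eqxx in ne_a.
Qed.

Lemma incident_off_edges_far u : u \notin nbhd -> u != x ->
  incident (edges e) u = incident off_edges u.
Proof.
rewrite inE => xu ux; apply/setP=> a; rewrite !inE -andbA.
have [xa|] //= := boolP (x \in a); rewrite andbF; apply/negP=> /andP[aE ua].
have : a \in incident (edges e) x by rewrite inE aE.
case/(incident_edgesP _ _ e_sym) => v exv av.
move: ua; rewrite av !inE (negbTE ux) => /eqP eu.
by rewrite eu exv in xu.
Qed.

Lemma card_edges_star : #|edges e| = #|off_edges| + #|nbhd|.
Proof.
rewrite -(cardsID (incident (edges e) x) (edges e)) addnC; congr (_ + _).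
  by apply: eq_card => a; rewrite !inE; case: (a \in edges e); rewrite //= ?andbT ?andbF.
rewrite -/(degree e x) degreeE //; apply: eq_card => a.
by rewrite !inE; case: (a \in edges e).
Qed.

Lemma card_incident_off u : u != x ->
  degree e u = #|incident off_edges u| + (u \in nbhd).
Proof.
move=> ux; rewrite degreeE //; have [uN|uN] := boolP (u \in nbhd).
  by have [-> nin] := incident_off_edges uN; rewrite cardsU1 nin addnC.
by rewrite incident_off_edges_far // addn0.
Qed.

(** Collisions within [nbhd :\: P] and within [P] are excluded by the greedy assignment, those
    between the two by the gap. Collisions with the vertices outside [x |: nbhd] are excluded by
    skipping labels on [nbhd :\: P] and by the last hypothesis on [P]. *)
Lemma star_completion (P : {set T}) (f : {set T} -> nat) :
  P \subset nbhd -> 1 < #|nbhd| -> #|~: (x |: nbhd)| <= #|P| ->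
  (forall u, degree e u <= #|nbhd|) ->
  {in off_edges, forall a, 1 <= f a <= #|off_edges|} ->
  {in off_edges &, injective f} ->
  {in ~: (x |: nbhd) &, injective (edge_sum off_edges f)} ->
  {in P & nbhd :\: P, forall p v,
     edge_sum off_edges f v + #|nbhd| <= edge_sum off_edges f p} ->
  {in P & ~: (x |: nbhd), forall p y o, #|off_edges| < o <= #|off_edges| + #|nbhd| ->
     edge_sum off_edges f p + o != edge_sum off_edges f y} ->
  antimagic e.
Proof.
set E1 := off_edges; set N := nbhd; set Y := ~: _; set M := #|E1|; set k := #|N|.
move=> PN k2 leYP ledeg fb finj winj gapP farP.
set w := edge_sum E1 f.
pose A := N :\: P; pose Z := [seq w y | y <- enum Y]; pose W := iota M.+1 k.
have cardN : k = #|P| + #|A| by rewrite /k -(cardsID P N) (setIidPr PN).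
have [|L1 [L1W L1inj L1sinj L1Z]] := @distinct_sum_assignment _ w A Z W (iota_uniq _ _).
  by rewrite size_iota size_map -cardE cardN leq_add2r.
pose ms := [seq L1 v | v <- enum A]; pose O := filter (predC (mem ms)) W.
have szO : #|P| <= size O.
  have := count_predC (mem ms) W; rewrite size_iota size_filter.
  suff : count (mem ms) W <= #|A| by move: cardN; lia.
  rewrite -size_filter cardE -(size_map L1) uniq_leq_size ?filter_uniq ?iota_uniq //.
  by move=> l; rewrite mem_filter => /andP[].
(* No value has to be avoided on [P]: [farP] holds for every star label. *)
have [|L2 [L2O L2inj L2sinj _]] :=
    @distinct_sum_assignment _ w P [::] O (filter_uniq _ (iota_uniq _ _)).
  by rewrite add0n.
pose L v := if v \in P then L2 v else L1 v.
have inA v : v \in N -> v \notin P -> v \in A by rewrite !inE => -> ->.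
have LW v : v \in N -> M < L v <= M + k.
  move=> vN; suff : L v \in W by rewrite mem_iota; lia.
  rewrite /L; case: ifPn => vP; last exact: L1W (inA _ vN vP).
  by have := L2O _ vP; rewrite mem_filter => /andP[].
have L12 u v : u \in P -> v \in A -> L2 u != L1 v.
  move=> uP vA; have := L2O _ uP; rewrite mem_filter => /andP[nin _].
  by apply: contraNneq nin => ->; apply: map_f; rewrite mem_enum.
have Linj : {in N &, injective L}.
  move=> u v uN vN; rewrite /L; case: ifPn => uP; case: ifPn => vP.
  - exact: L2inj.
  - by move/eqP; rewrite (negbTE (L12 _ _ uP (inA _ vN vP))).
  - by move/eqP; rewrite eq_sym (negbTE (L12 _ _ vP (inA _ uN uP))).
  - by apply: L1inj; apply: inA.
(* Two star labels differ by less than [k], so a gap of [k] between the partial sums decides. *)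
have sPA p v : p \in P -> v \in A -> w v + L1 v < w p + L2 p.
  move=> pP vA; have := gapP p v pP vA; rewrite -/w.
  have := LW p (subsetP PN p pP); have vN : v \in N by move: vA; rewrite !inE => /andP[].
  have := LW v vN; rewrite /L pP; move: vA; rewrite inE => /andP[/negbTE-> _]; lia.
have sinj : {in N &, injective (fun v => w v + L v)}.
  move=> u v uN vN; rewrite /L; case: ifPn => uP; case: ifPn => vP.
  - exact: L2sinj.
  - by move=> eqs; have := sPA u v uP (inA _ vN vP); rewrite eqs ltnn.
  - by move=> eqs; have := sPA v u vP (inA _ uN uP); rewrite eqs ltnn.
  - by apply: L1sinj; apply: inA.
have sY v y : v \in N -> y \in Y -> w v + L v != w y.
  move=> vN yY; case: (boolP (v \in P)) => vP; first exact: farP (LW _ vN).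
  rewrite /L (negbTE vP); apply: contraNneq (L1Z v (inA _ vN vP)) => ->.
  by apply: map_f; rewrite mem_enum.
(* For an edge [[set x; v]] the sum has the single term [L v]; it serves to read [v] off the
   edge. *)
pose F (a : {set T}) := if x \in a then \sum_(v in a :\ x) L v else f a.
have Fx v : v \in N -> F [set x; v] = L v.
  move=> vN; have vx : x != v by apply: contraTneq vN => <-; apply: x_notin_nbhd.
  rewrite /F set21; suff -> : [set x; v] :\ x = [set v] by rewrite big_set1.
  by apply/setP=> u; rewrite !inE; case: eqVneq => //= ->; rewrite (negbTE vx).
have FE1 a : a \in E1 -> F a = f a by rewrite inE /F => /andP[_ /negbTE->].
have wFE1 u : \sum_(a in incident E1 u) F a = w u.
  by apply: eq_bigr => a; rewrite inE => /andP[/FE1].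
have wFN u : u \in N -> edge_sum (edges e) F u = w u + L u.
  move=> uN; rewrite /edge_sum.
  by have [-> nin] := incident_off_edges uN; rewrite big_setU1 //= wFE1 Fx // addnC.
have wFY u : u \in Y -> edge_sum (edges e) F u = w u.
  by rewrite !inE negb_or => /andP[ux uN]; rewrite /edge_sum incident_off_edges_far ?inE.
have wFx : edge_sum (edges e) F x = \sum_(v in N) L v.
  rewrite /edge_sum incident_edges // big_imset /=; last exact: neighbour_edge_inj.
  by apply: eq_bigr => v; apply: Fx.
have wle u : w u <= #|incident E1 u| * M.
  by apply: edge_sum_le => a /fb/andP[].
(* For [u] in [N] the label [L u] cancels; at most [k - 1] labels of size at most [M] then face
   [k - 1] labels above [M]. For [u] in [Y] the same comparison is made with [k] labels on each
   side. *)
have xmax u : u != x -> edge_sum (edges e) F u < edge_sum (edges e) F x.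
  move=> ux; rewrite wFx; have [uN|uN] := boolP (u \in N).
    rewrite wFN // (big_setD1 u uN) /= addnC ltn_add2l.
    have : \sum_(v in N :\ u) M.+1 <= \sum_(v in N :\ u) L v.
      by apply: leq_sum => v /setD1P[_ vN]; have := LW v vN; lia.
    apply: leq_trans; rewrite sum_nat_const.
    have := ledeg u; rewrite card_incident_off // -/N uN addn1.
    have := cardsD1 u N; rewrite uN; have := wle u; move: k2; rewrite -/k -/E1.
    move: #|N :\ u| #|incident _ _| (w u) => r i s; nia.
  rewrite wFY ?inE ?negb_or ?ux ?uN //; last by move: uN; rewrite inE.
  have : \sum_(v in N) M.+1 <= \sum_(v in N) L v.
    by apply: leq_sum => v vN; have := LW v vN; lia.
  apply: leq_trans; rewrite sum_nat_const -/k.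
  have := ledeg u; rewrite card_incident_off // -/N (negbTE uN) addn0.
  by have := wle u; move: k2; rewrite -/k -/E1; move: #|incident _ _| (w u) => i s; nia.
have edgeE a : a \in edges e -> a \in E1 \/ exists2 v, v \in N & a = [set x; v].
  move=> aE; have [xa|xa] := boolP (x \in a); last by left; rewrite inE aE.
  have : a \in incident (edges e) x by rewrite inE aE.
  by case/(incident_edgesP _ _ e_sym) => v exv ->; right; exists v; rewrite ?inE.
exists F; split.
  apply: injective_edge_labelling; rewrite ?card_edges_star -/E1 -/N -/M -/k.
    move=> a /edgeE[aE|[v vN ->]]; first by rewrite FE1 //; have := fb a aE; rewrite -/M; lia.
    by rewrite Fx //; have := LW v vN; lia.
  move=> a b /edgeE[aE|[v vN ->]] /edgeE[bE|[u uN ->]].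
  - by rewrite !FE1 //; apply: finj.
  - rewrite (FE1 a aE) (Fx u uN) => eqf; have := fb a aE; have := LW u uN; rewrite eqf; lia.
  - rewrite (FE1 b bE) (Fx v vN) => eqf; have := fb b bE; have := LW v vN; rewrite eqf; lia.
  - by rewrite !Fx // => /Linj ->.
have side u : u != x -> u \in N \/ u \in Y.
  by move=> ux; rewrite !inE (negbTE ux) /=; case: (e x u); [left | right].
move=> u v; rewrite !vertex_sumE //.
have [->|ux] := eqVneq u x; have [->|vx] := eqVneq v x => //.
- by move=> eqs; have := xmax _ vx; rewrite eqs ltnn.
- by move=> eqs; have := xmax _ ux; rewrite eqs ltnn.
case: (side u ux) => uS; case: (side v vx) => vS;
  rewrite ?(wFN u uS) ?(wFY u uS) ?(wFN v vS) ?(wFY v vS).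
- exact: sinj.
- by move/eqP; rewrite (negbTE (sY _ _ uS vS)).
- by move/esym/eqP; rewrite (negbTE (sY _ _ vS uS)).
- exact: winj.
Qed.
End Star.

(** * Correcting one vertex by an exchange of labels *)

(* Four blocks of five labels at distance k: a window of length k contains at most one label
   of each residue mod k, hence at most five of them. *)
Definition spaced_labels (k : nat) : seq nat :=
  [seq c * k + i | c <- iota 0 4, i <- iota 1 5].

Lemma spaced_labelsP k l : 5 < k -> l \in spaced_labels k ->
  [/\ 1 <= l %% k <= 5, 1 <= l & l <= 3 * k + 5].
Proof.
move=> k5 /allpairsP[[c i] []]; rewrite !mem_iota => /= c4 i5 ->.
rewrite modnMDl modn_small; last by lia.
by split; nia.
Qed.

Lemma spaced_labels_uniq k : 5 < k -> uniq (spaced_labels k).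
Proof.
move=> k5; apply: allpairs_uniq; rewrite ?iota_uniq // => -[c i] [d j].
move=> /allpairsP[[c1 i1] [+ + [-> ->]]] /allpairsP[[c2 i2] [+ + [-> ->]]].
rewrite !mem_iota => /= _ i1P _ i2P eqs; have eqi : i1 = i2.
  by have := congr1 (modn^~ k) eqs; rewrite !modnMDl !modn_small //; lia.
move/eqP: eqs; rewrite eqi eqn_add2r eqn_pmul2r; last by lia.
by move/eqP->.
Qed.

Lemma size_spaced_labels k : size (spaced_labels k) = 20.
Proof. by rewrite size_allpairs !size_iota. Qed.

Lemma spaced_labels_window k a b : 5 < k ->
  size [seq l <- spaced_labels k | a < b + l <= a + k] <= 5.
Proof.
move=> k5; rewrite -(size_map (modn^~ k)) -[leqRHS](size_iota 1 5).
apply: uniq_leq_size => [|r /mapP[l]].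
  rewrite map_inj_in_uniq ?filter_uniq ?spaced_labels_uniq // => l l'.
  rewrite !mem_filter => /andP[lw _] /andP[lw' _] eqm.
  rewrite (divn_eq l k) (divn_eq l' k) eqm; congr (_ * _ + _).
  move: (divn_eq l k) (divn_eq l' k); rewrite eqm.
  move: (l %/ k) (l' %/ k) (l' %% k) => u u' r; nia.
rewrite mem_filter => /andP[_ /spaced_labelsP[//|lm _ _] ->].
by rewrite mem_iota; lia.
Qed.

Section Avoid.
Variables (T : finType) (E : {set {set T}}) (f : {set T} -> nat).
Hypothesis finj : {in E &, injective f}.

Lemma exists_avoiding (C : {set {set T}}) (bad : seq nat) :
  C \subset E -> size bad < #|C| -> exists2 c, c \in C & f c \notin bad.
Proof.
move=> CE ltC; apply/exists_inP/contraT; rewrite negb_exists_in => /forall_inP Cbad.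
suff : #|C| <= size bad by rewrite leqNgt ltC.
apply: (@card_labels_le _ _ f); first by move=> a b /(subsetP CE) + /(subsetP CE) +; apply: finj.
by move=> c /Cbad; rewrite negbK.
Qed.

(** The case [c = g] is the empty exchange; it keeps the present label of [g] among the
    candidates. *)
Lemma edge_sum_swap g c y : g \in E -> c \in E -> y \in g -> c = g \/ y \notin c ->
  edge_sum E (f \o tperm g c) y + f g = edge_sum E f y + f c.
Proof.
move=> gE cE yg [->|yc]; last exact: edge_sum_tperm1.
by rewrite edge_sum_tperm.
Qed.

Variables (y : T) (g : {set T}).
Hypotheses (gE : g \in E) (yg : y \in g).

(** Each value of [Z] excludes one label for [g], and there are [#|C| + 1] candidates, [g]
    included. *)
Lemma swap_avoiding (C : {set {set T}}) (Z : seq nat) :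
  C \subset E -> {in C, forall c : {set T}, y \notin c} -> size Z <= #|C| ->
  exists2 c, c \in g |: C & edge_sum E (f \o tperm g c) y \notin Z.
Proof.
move=> CE yC leZ; have gC : g \notin C by apply: contraL yg => /yC.
have gCE : g |: C \subset E by rewrite subUset sub1set gE.
pose bad := [seq z + f g - edge_sum E f y | z <- Z].
have [|c cC cbad] := @exists_avoiding (g |: C) bad gCE.
  by rewrite size_map cardsU1 gC.
exists c => //; apply: contra cbad => zZ; apply/mapP; eexists; first exact: zZ.
rewrite (edge_sum_swap gE (subsetP gCE _ cC) yg) ?addKn //.
by move: cC; rewrite in_setU1; case/orP=> [/eqP|/yC] ?; [left | right].
Qed.

(** An entry of [ps] reaches an interval of [k] consecutive sums, which excludes at most five spaced
    labels; a value of [Z] excludes one. *)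
Lemma swap_avoiding_windows (C : {set {set T}}) k M (Z ps : seq nat) :
  5 < k -> C \subset E -> {in C, forall c : {set T}, y \notin c} ->
  {in g |: C, forall c, f c \in spaced_labels k} ->
  size Z + 5 * size ps <= #|C| ->
  exists c, [/\ c \in g |: C, edge_sum E (f \o tperm g c) y \notin Z
    & forall wp o, wp \in ps -> M < o <= M + k ->
        wp + o != edge_sum E (f \o tperm g c) y].
Proof.
move=> k5 CE yC fC leZ; have gC : g \notin C by apply: contraL yg => /yC.
have gCE : g |: C \subset E by rewrite subUset sub1set gE.
(* The labels [l] for which the new sum at [y], the old one plus [l] minus [f g], is of the form
   [wp + o] with [M < o <= M + k]. *)
pose window wp := [seq l <- spaced_labels k |
  wp + M + f g < edge_sum E f y + l <= wp + M + f g + k].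
pose bad := [seq z + f g - edge_sum E f y | z <- Z] ++ flatten [seq window wp | wp <- ps].
have [|c cC cbad] := @exists_avoiding (g |: C) bad gCE.
  rewrite size_cat size_map cardsU1 gC ltnS (leq_trans _ leZ) // leq_add2l.
  rewrite {leZ bad}; elim: ps => //= wp ps IHps.
  by rewrite size_cat mulnS leq_add // spaced_labels_window.
have eqs : edge_sum E (f \o tperm g c) y + f g = edge_sum E f y + f c.
  rewrite (edge_sum_swap gE (subsetP gCE _ cC) yg) //.
  by move: cC; rewrite in_setU1; case/orP=> [/eqP|/yC] ?; [left | right].
exists c; split=> //.
  apply: contra cbad => zZ; rewrite mem_cat; apply/orP; left.
  by apply/mapP; eexists; [exact: zZ | rewrite eqs addKn].
move=> wp o wpP oM; apply: contra cbad => /eqP eqo; rewrite mem_cat; apply/orP; right.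
apply/flattenP; exists (window wp); first exact: map_f.
by rewrite mem_filter fC // andbT -eqs -eqo; lia.
Qed.
End Avoid.

(** The difference of the two sides is (i - 7)(i - 8), which is nonnegative on integers. *)
Lemma quadratic_bound i : 15 * i <= i * i + 56.
Proof.
do 15![case: i => [//|i]].
by apply: leq_trans (leq_addr _ _); rewrite leq_mul2r orbT.
Qed.

(** * Domination of a vertex by one whose edges carry the top labels *)

Section Gap.
Variables (T : finType) (E S : {set {set T}}) (f : {set T} -> nat) (M : nat).
Hypotheses (finj : {in E &, injective f}) (fM : {in E, forall a, f a <= M}).
Hypotheses (SE : S \subset E) (SM : #|S| <= M) (topS : {in E, forall a, (a \in S) = (M < f a + #|S|)}).

Lemma top_sum_ge (X : {set {set T}}) : X \subset S ->
  #|X| * (M - #|S|).*2 + #|X| * #|X|.+1 <= (\sum_(a in X) f a).*2.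
Proof.
move=> XS; have XE := subset_trans XS SE.
apply: sum_distinct_ge => [a b aX bX|a aX]; first by apply: finj; apply: subsetP XE _ _.
have : M < f a + #|S| by rewrite -topS ?(subsetP XS) ?(subsetP XE).
by move: SM; lia.
Qed.

(** Common edges cancel. Every remaining edge at [p] has a label above [M - #|S|]. At [v] at most
    two remaining edges exceed that level, each by at most [#|S|], and one edge is either cheap (at
    most [q]) or missing. The advantage of about [M - #|S|] so gained outweighs the excess. *)
Lemma edge_sum_gap (p v : T) (n q : nat) :
  incident E p \subset S -> #|incident E p :&: incident E v| <= 1 ->
  #|(incident E v :\: incident E p) :&: S| <= 2 ->
  #|incident E v| <= #|incident E p| -> #|S| <= 3 * #|incident E p| ->
  (exists a, [/\ a \in incident E v, a \notin S & f a <= q])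
    \/ #|incident E v| < #|incident E p| ->
  1 < #|incident E p| -> 18 <= n -> 6 * n + 4 <= M -> q <= n + 13 ->
  edge_sum E f v + (n - 4) <= edge_sum E f p.
Proof.
move=> pS com vS vp S3 low p2 n18 Mn qn.
rewrite /edge_sum (big_setID (incident E p)) /= [leqRHS](big_setID (incident E v)) /=.
rewrite setIC -addnA leq_add2l.
set X := incident E p :\: _; set V := incident E v :\: _.
have cX : #|X| + #|incident E p :&: incident E v| = #|incident E p|.
  by rewrite addnC cardsID.
have cV : #|V| + #|incident E p :&: incident E v| = #|incident E v|.
  by rewrite addnC setIC cardsID.
have leVX : #|V| <= #|X|.
  by rewrite -(leq_add2r #|incident E p :&: incident E v|) cV cX.
have sumX : #|X| * (M - #|S|).*2 + #|X| * #|X|.+1 <= (\sum_(a in X) f a).*2.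
  by apply: top_sum_ge; apply: subset_trans (subsetDl _ _) pS.
(* Each label is at most [M - #|S|], plus [#|S|] for the at most two edges in [S]. *)
have sumU (U : {set {set T}}) : U \subset V ->
    \sum_(a in U) f a <= #|U| * (M - #|S|) + 2 * #|S|.
  move=> UV; have UE a : a \in U -> a \in E.
    by move/(subsetP UV); rewrite !inE => /andP[_ /andP[]].
  apply: leq_trans (_ : \sum_(a in U) ((M - #|S|) + (a \in S) * #|S|) <= _).
    apply: leq_sum => a /UE aE; have := topS aE; have := fM aE.
    by case: (a \in S); lia.
  rewrite big_split /= sum_nat_const leq_add2l -big_distrl leq_mul2r; apply/orP; right.
  rewrite -big_mkcondr sum1dep_card (leq_trans _ vS) // subset_leq_card //.
  by apply/subsetP=> a; rewrite !inE => /andP[/(subsetP UV)]; rewrite !inE => -> ->.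
have sumV : \sum_(a in V) f a <= q + #|X|.-1 * (M - #|S|) + 2 * #|S|.
  case: low => [[a [av aS fa]]|lt_vp].
    have aV : a \in V by rewrite in_setD av andbT; apply: contra aS; apply: (subsetP pS).
    rewrite (big_setD1 a aV) /= -addnA leq_add //.
    have := sumU (V :\ a) (subsetDl _ _).
    have -> : #|V :\ a| = #|V|.-1 by rewrite (cardsD1 a V) aV.
    move=> /leq_trans; apply; rewrite leq_add2r leq_mul2r.
    by rewrite -!subn1 leq_sub2r ?orbT.
  have ltVX : #|V| < #|X|.
    by rewrite -(ltn_add2r #|incident E p :&: incident E v|) cV cX.
  have := sumU V (subxx _); move/leq_trans; apply; rewrite -addnA.
  apply: leq_trans (leq_addl _ _); rewrite leq_add2r leq_mul2r -ltnS prednK ?ltVX ?orbT //.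
  exact: leq_ltn_trans ltVX.
move: sumX sumV cX com S3 SM Mn qn n18 p2.
move: #|X| #|S| #|incident E p| (\sum_(a in X) _) (\sum_(a in V) _) #|_ :&: _|.
(* [X] is nonempty, as [p] has at least two edges and shares at most one. *)
case=> [|s] t d sX sV c /=; first by move=> _ _ <-; lia.
move=> lesX lesV cX c1 td tM Mn qn n18 d2.
have [r Mr] : exists r, M = r + t by exists (M - t); lia.
(* With [#|X| = s + 1] and [t <= 3 * (s + 2)], twice the difference of the sums contains (s + 1)(s +
   2) - 6t, in which s has coefficient 3 - 18 = -15. *)
have sq := quadratic_bound s.
by move: lesX lesV; rewrite Mr addnK => lesX lesV; lia.
Qed.
End Gap.

(** At most [#|S|] entries of [O] are already used by [f]; the others are free for [S']. *)
Lemma injection_extend_fresh (T : finType) (S S' : {set T}) (f : T -> nat) (O : seq nat) :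
  {in S &, injective f} -> [disjoint S & S'] -> uniq O -> #|S| + #|S'| <= size O ->
  exists f' : T -> nat,
    [/\ {in S, f' =1 f}, {in S', forall a, f' a \in O}
      & {in S :|: S' &, injective f'}].
Proof.
move=> finj dis uniqO leO; pose ms := [seq f a | a <- enum S].
have [|a aS|f' [f'S f'O f'inj]] :=
  @injection_extend _ S S' f (filter (predC (mem ms)) O) finj dis (filter_uniq _ uniqO).
- rewrite size_filter -(leq_add2l (count (mem ms) O)) count_predC.
  apply: leq_trans leO; rewrite leq_add2r -size_filter cardE -(size_map f).
  rewrite uniq_leq_size ?filter_uniq // => l.
  by rewrite mem_filter => /andP[].
- by rewrite mem_filter /= map_f ?mem_enum.
by exists f'; split=> // a /f'O; rewrite mem_filter => /andP[].
Qed.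

(** * Layered labellings *)

Definition labels (T : finType) (E : {set T}) (f : T -> nat) : Prop :=
  {in E, forall a, 1 <= f a <= #|E|} /\ {in E &, injective f}.

(** The new elements take the labels directly after those in use, so the labels stay consecutive. *)
Lemma labels_raise (T : finType) (E S S' : {set T}) f :
  S' \subset S -> S \subset E -> labels (E :\: S) f ->
  exists2 f', labels (E :\: S') f' &
    {in E :\: S, f' =1 f} /\ {in S :\: S', forall a, #|E :\: S| < f' a}.
Proof.
move=> S'S SE [fb finj]; pose U := E :\: S.
have dis : [disjoint U & S :\: S'].
  by rewrite -setI_eq0; apply/eqP/setP=> a; rewrite !inE; case: (a \in S); rewrite ?andbF.
have ES' : E :\: S' = U :|: (S :\: S').
  apply/setP=> a; rewrite !inE; have := subsetP S'S a; have := subsetP SE a.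
  by case: (a \in S) => [->//|_ /contraFF->]; rewrite ?andbT ?orbF.
have cES' : #|E :\: S'| = #|U| + #|S :\: S'|.
  by rewrite ES' cardsU (disjoint_setI0 dis) cards0 subn0.
have [||f' [f'U f'O f'inj]] :=
  @injection_extend _ U (S :\: S') f (iota #|U|.+1 #|S :\: S'|) finj dis (iota_uniq _ _).
- by rewrite size_iota.
- by move=> a /fb; rewrite mem_iota -/U; lia.
exists f'; last by split=> // a /f'O; rewrite mem_iota => /andP[].
split; last by rewrite ES'.
move=> a; rewrite cES' ES' => /setUP[aU|/f'O]; last by rewrite mem_iota; lia.
by rewrite f'U //; have := fb _ aU; rewrite -/U; lia.
Qed.

(* The labels of S are the #|S| largest ones among 1, ..., #|E|. *)
Definition on_top (T : finType) (E S : {set T}) (f : T -> nat) : Prop :=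
  {in E, forall a, (a \in S) = (#|E| < f a + #|S|)}.

Lemma on_topI (T : finType) (E S : {set T}) f :
  S \subset E -> {in E :\: S, forall a, f a <= #|E :\: S|} ->
  {in S, forall a, #|E :\: S| < f a} -> on_top E S f.
Proof.
move=> SE fle fgt a aE; rewrite -(cardsID S E) (setIidPr SE) addnC ltn_add2r.
have [aS|aS] := boolP (a \in S); first by rewrite fgt.
by apply/esym/negbTE; rewrite -leqNgt fle // in_setD aS.
Qed.

(** Labels are given from the bottom: [K] draws from [lam], [Q] from the rest of 1, ..., [q], then
    the rest of [E :\: S1] is filled, and finally the layers [S1 :\: S2], [S2 :\: S3] and [S3] are
    added in turn. *)
Lemma exists_layered_labels (T : finType) (E K Q S1 S2 S3 : {set T}) (lam : seq nat) q :
  S3 \subset S2 -> S2 \subset S1 -> S1 \subset E ->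
  K \subset E :\: S1 -> Q \subset E :\: S1 -> [disjoint K & Q] ->
  uniq lam -> #|K| <= size lam -> {in lam, forall l, 1 <= l <= #|E :\: S1|} ->
  #|K| + #|Q| <= q <= #|E :\: S1| ->
  exists f, [/\ labels E f, {in K, forall a, f a \in lam}, {in Q, forall a, f a <= q}
    & [/\ on_top E S1 f, on_top E S2 f & on_top E S3 f]].
Proof.
move=> S32 S21 S1E KE QE disKQ ulam leK lamb /andP[leKQ leqU].
pose U := E :\: S1.
have [|||||fK [_ fKlam fKinj]] := @injection_extend _ set0 K (fun=> 0) lam.
- by move=> a b; rewrite inE.
- by rewrite -setI_eq0 set0I.
- exact: ulam.
- exact: leK.
- by move=> a; rewrite inE.
rewrite set0U in fKinj.
have [|fQ [fQK fQq fQinj]] :=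
  @injection_extend_fresh _ K Q fK (iota 1 q) fKinj disKQ (iota_uniq _ _).
  by rewrite size_iota.
have KQU : K :|: Q \subset U by rewrite subUset KE.
have [||f0 [f0KQ f0U f0inj]] :=
  @injection_extend_fresh _ (K :|: Q) (U :\: (K :|: Q)) fQ (iota 1 #|U|) fQinj _ (iota_uniq _ _).
- by rewrite -setI_eq0 setIDA setIC -setIDA setDv setI0.
- by rewrite size_iota -(cardsID (K :|: Q) U) (setIidPr KQU).
have UE : (K :|: Q) :|: (U :\: (K :|: Q)) = U by rewrite -{1}(setIidPr KQU) setID.
have lab0 : labels U f0.
  split; last by rewrite -UE.
  move=> a aU; have [aKQ|aKQ] := boolP (a \in K :|: Q).
    rewrite f0KQ //; have [aK|aK] := boolP (a \in K).
      by rewrite fQK //; apply: lamb; apply: fKlam.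
    have /fQq : a \in Q by move: aKQ; rewrite inE (negbTE aK).
    by rewrite mem_iota add1n ltnS => /andP[-> fq]; apply: leq_trans fq leqU.
  have /f0U : a \in U :\: (K :|: Q) by rewrite in_setD aKQ.
  by rewrite mem_iota add1n ltnS.
have [f1 lab1 [f1U f1S]] := labels_raise S21 S1E lab0.
have S2E := subset_trans S21 S1E.
have [f2 lab2 [f2U f2S]] := labels_raise S32 S2E lab1.
have S3E := subset_trans S32 S2E.
have [f lab [fU fS]] := labels_raise (sub0set S3) S3E lab2.
rewrite !setD0 in lab fS.
have UU (S S' : {set T}) : S \subset S' -> {subset E :\: S' <= E :\: S}.
  by move=> SS' a /setDP[aE aS]; rewrite in_setD aE andbT; apply: contra aS; apply: subsetP.
have fE a : a \in U -> f a = f0 a.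
  move=> aU; have aU2 := UU _ _ S21 a aU.
  by rewrite fU ?f2U ?f1U // (UU _ _ S32).
exists f; split=> //.
- move=> a aK; have aU := subsetP KE a aK.
  by rewrite fE // f0KQ ?inE ?aK // fQK // fKlam.
- move=> a aQ; have aU := subsetP QE a aQ.
  by rewrite fE // f0KQ ?inE ?aQ ?orbT //; have := fQq a aQ; rewrite mem_iota add1n ltnS => /andP[].
have f2E a : a \in E :\: S2 -> f a = f1 a.
  by move=> aU; rewrite fU ?f2U // (UU _ _ S32).
have le12 : #|E :\: S1| <= #|E :\: S2| := subset_leq_card (setDS E S21).
have le23 : #|E :\: S2| <= #|E :\: S3| := subset_leq_card (setDS E S32).
have gt3 a : a \in S3 -> #|E :\: S3| < f a by apply: fS.
have gt2 a : a \in S2 -> #|E :\: S2| < f a.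
  move=> a2; have [/gt3|a3] := boolP (a \in S3); first exact: leq_ltn_trans.
  by rewrite fU ?f2S // in_setD a3 ?a2 ?(subsetP S2E).
have gt1 a : a \in S1 -> #|E :\: S1| < f a.
  move=> a1; have [/gt2|a2] := boolP (a \in S2); first exact: leq_ltn_trans.
  by rewrite f2E ?f1S // in_setD a2 ?a1 ?(subsetP S1E).
split; apply: on_topI => // a aU.
- by rewrite fE //; have /andP[] := lab0.1 a aU.
- by rewrite f2E //; have /andP[] := lab1.1 a aU.
- by rewrite fU //; have /andP[] := lab2.1 a aU.
Qed.

(** * Labelling the edges that avoid x *)

Lemma star_card_le (T : finType) (u : T) (U : {set T}) (S : {set {set T}}) :
  {in S, forall a, exists2 v, v \in U & a = [set u; v]} -> #|S| <= #|U|.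
Proof.
move=> SU; apply: leq_trans (leq_imset_card (fun v => [set u; v]) U).
by apply/subset_leq_card/subsetP=> a /SU[v vU ->]; apply: imset_f.
Qed.

Lemma exists_subset_card (T : finType) (S : {set T}) n :
  n <= #|S| -> exists2 U : {set T}, U \subset S & #|U| = n.
Proof.
case/card_geqP=> s [us <- sS]; exists [set a in s].
  by apply/subsetP=> a; rewrite inE => /sS.
by rewrite cardsE; apply/card_uniqP.
Qed.

Lemma mem_incident (T : finType) (E : {set {set T}}) u a :
  (a \in incident E u) = (a \in E) && (u \in a).
Proof. by rewrite inE. Qed.

Lemma in_set3 (T : finType) (u a b c : T) :
  (u \in [set a; b; c]) = [|| u == a, u == b | u == c].
Proof. by rewrite !inE orbA. Qed.

Section Core.
Variables (T : finType) (e : rel T).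
Hypotheses (e_sym : symmetric e) (e_irr : irreflexive e).
Variable x : T.

Local Notation E := (off_edges e x).
Local Notation N := (nbhd e x).
Local Notation Y := (~: (x |: nbhd e x)).
Local Notation D u := #|incident E u|.

Lemma off_edgeP u a : a \in incident E u ->
  exists v, [/\ a = [set u; v], v != u, v \in N :|: Y & u != x].
Proof.
rewrite !inE -andbA => /and3P[aE xa ua].
have : a \in incident (edges e) u by rewrite inE aE.
case/(incident_edgesP _ _ e_sym) => v euv av; exists v.
have /andP[xu xv] : (x != u) && (x != v) by move: xa; rewrite av !inE negb_or.
split; [exact: av | | | by rewrite eq_sym].
  by apply: contraTneq euv => ->; rewrite e_irr.
by rewrite in_setU in_setC in_setU1 [v == x]eq_sym (negbTE xv) /= orbN.
Qed.

Lemma mem_off_edges u v : e u v -> u != x -> v != x -> [set u; v] \in E.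
Proof.
by move=> euv ux vx; rewrite inE mem_edges // !inE negb_or ![x == _]eq_sym ux.
Qed.

Lemma Y_neq y : y \in Y -> y != x /\ y \notin N.
Proof. by rewrite !inE negb_or => /andP[]. Qed.

Lemma N_neq v : v \in N -> v != x /\ v \notin Y.
Proof.
move=> vN; split; last by rewrite in_setC in_setU1 vN orbT.
by apply: contraTneq vN => ->; rewrite x_notin_nbhd.
Qed.

Variables (p1 p2 p3 : T).
Local Notation P := [set p1; p2; p3].
Local Notation A := (N :\: P).
(* T3, T2 and T1 are nested; their edges get the top labels, those of T3 being the largest.
   This order keeps the deficit of p_i against a neighbour of the other p_j proportional to
   the degree of p_i. *)
Local Notation T3 := (incident E p3).
Local Notation T2 := (T3 :|: incident E p2).
Local Notation T1 := (T2 :|: incident E p1).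
Hypotheses (PN : P \subset N) (cardP : #|P| = 3) (cardY : #|Y| = 3).
Hypotheses (degE : forall u, degree e u <= #|N|).
Hypotheses (k14 : 14 <= #|N|) (ge_M : 6 * #|N| + 28 <= #|E|).
Hypotheses (D12 : D p2 <= D p1) (D23 : D p3 <= D p2) (D3 : 8 <= D p3).
Hypothesis (DA : {in A, forall v, D v <= D p3}).

Lemma mem_T1 a : (a \in T1) = (a \in E) && [exists p in P, p \in a].
Proof.
apply/idP/andP => [|[aE /exists_inP[p]]].
  rewrite !in_setU => /orP[/orP[]|]; rewrite mem_incident => /andP[aE pa].
  - by split=> //; apply/exists_inP; exists p3; rewrite ?inE ?eqxx ?orbT.
  - by split=> //; apply/exists_inP; exists p2; rewrite ?inE ?eqxx ?orbT.
  - by split=> //; apply/exists_inP; exists p1; rewrite ?inE ?eqxx ?orbT.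
by rewrite in_set3 => /or3P[]/eqP-> pa; rewrite !in_setU !mem_incident aE pa ?orbT.
Qed.

Lemma D_N u : u \in N -> D u < #|N|.
Proof.
move=> uN; have [ux _] := N_neq uN.
by have := degE u; rewrite (card_incident_off e_sym e_irr ux) uN addn1.
Qed.

Lemma memP : [/\ p1 \in P, p2 \in P & p3 \in P].
Proof. by rewrite !inE !eqxx ?orbT. Qed.

Lemma card_T1 : #|T1| + 3 <= 3 * #|N|.
Proof.
have [m1 m2 m3] := memP.
have := D_N (subsetP PN _ m1); have := D_N (subsetP PN _ m2); have := D_N (subsetP PN _ m3).
have := (leq_card_setU T2 (incident E p1)).1.
have := (leq_card_setU T3 (incident E p2)).1.
move: #|T1| #|T2| #|T3| (D p1) (D p2) #|N|; clear; lia.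
Qed.

Lemma notin_P (a : {set T}) : {in a, forall v : T, v \in A :|: Y} -> a \notin T1.
Proof.
move=> aAY; rewrite mem_T1 negb_and; apply/orP; right; apply/exists_inPn=> p pP.
apply/negP=> /aAY; rewrite in_setU in_setD pP /=.
by have [_ /negbTE->] := N_neq (subsetP PN _ pP).
Qed.

(** * Low edges and spare edges *)

Variables (y1 y2 y3 z1 z2 z3 : T).
Hypothesis (defY : Y = [set y1; y2; y3]).
Hypotheses (e1 : e y1 z1) (e2 : e y2 z2) (e3 : e y3 z3).
(** The edges whose labels are exchanged in order to correct [y1], [y2], [y3]. *)
Local Notation Gs := [set [set y1; z1]; [set y2; z2]; [set y3; z3]].

Lemma card_Gs : #|Gs| <= 3.
Proof. by rewrite (leq_trans (leq_card_setU _ _)) // cards1 cards2; case: (_ != _). Qed.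

(* Edges to Y are preferred as low edges because there may be as few as about 30 edges
   inside A, 17 of which must remain available as spare edges. *)
Definition low_Y v (a : {set T}) := [&& a \in incident E v, a \notin Gs & [exists y in Y, y \in a]].
Definition low_A v (a : {set T}) := (a \in incident E v) && (a \subset A).
Definition low v : option {set T} :=
  if [pick a | low_Y v a] is Some a then Some a else [pick a | low_A v a].
Definition lows : {set {set T}} := [set a | [exists v in A, low v == Some a]].
Local Notation AA := [set a in E | a \subset A].
(** Only for these vertices is the low edge taken inside [A]. *)
Local Notation A0 := [set v in A | [forall a, ~~ low_Y v a]].

Lemma cardA : #|A| + 3 = #|N|.
Proof. by rewrite -cardP addnC -(cardsID P N) (setIidPr PN). Qed.

Lemma lowP v a : low v = Some a -> low_Y v a \/ low_A v a.
Proof.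
by rewrite /low; case: pickP => [b ? [<-]|_]; [left | case: pickP => [b ? [<-]|]; [right|]].
Qed.

Lemma A_neq_Y v y : v \in A -> y \in Y -> v != y.
Proof.
by move=> vA yY; apply: contraTneq vA => ->; rewrite in_setD (negbTE (Y_neq yY).2) andbF.
Qed.

Lemma lows_notin_T1 a : a \in lows -> a \in E :\: T1.
Proof.
rewrite inE => /exists_inP[v vA /eqP/lowP low_a]; rewrite in_setD; apply/andP; split.
  apply: notin_P => u ua; case: low_a => [/and3P[av _ /exists_inP[y yY ya]]|/andP[_ aA]].
    have [w [aE wv _ _]] := off_edgeP av.
    have vy := A_neq_Y vA yY.
    have wy : w = y by move: ya; rewrite aE !inE (eq_sym y) (negbTE vy) => /eqP.
    by move: ua; rewrite aE wy => /set2P[->|->]; rewrite in_setU ?vA ?yY ?orbT.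
  by rewrite in_setU (subsetP aA).
by case: low_a => [/and3P[]|/andP[]]; rewrite mem_incident => /andP[].
Qed.

Lemma Some_set_inj : injective (@Some {set T}). Proof. by move=> a b []. Qed.

Lemma card_lows : #|lows| <= #|A|.
Proof.
rewrite -(card_imset _ Some_set_inj); apply: leq_trans (leq_imset_card low A).
apply/subset_leq_card/subsetP=> o /imsetP[a + ->]; rewrite inE => /exists_inP[v vA /eqP <-].
exact: imset_f.
Qed.

(** An edge avoiding x lies inside [A], meets [P], belongs to [Gs], lies inside [Y], or joins
    [A :\: A0] to [Y]. Writing k for [#|N|], the last four classes have at most 3k - 3, 3, 9 and 3(k
    - 3 - [#|A0|]) edges, and [lows] takes at most [#|A0|] edges inside [A]; at least 28 remain. *)
Lemma card_AA_lows : 17 <= #|AA :\: lows|.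
Proof.
have leI : #|lows :&: AA| <= #|A0|.
  rewrite -(card_imset _ Some_set_inj); apply: leq_trans (leq_imset_card low A0).
  apply/subset_leq_card/subsetP=> o /imsetP[a + ->]; rewrite in_setI => /andP[].
  rewrite inE => /exists_inP[v vA /eqP low_v]; rewrite inE => /andP[_ aA].
  rewrite -low_v imset_f // inE vA; apply/forallP=> b; apply/negP=> bY.
  move: low_v; rewrite /low; case: pickP => [c cY [ca]|/(_ b)]; last by rewrite bY.
  case/and3P: cY => _ _ /exists_inP[y yY]; rewrite ca => /(subsetP aA) yA.
  by have := A_neq_Y yA yY; rewrite eqxx.
pose AY := [set [set q.1; q.2] | q in setX (A :\: A0) Y].
pose YY := [set [set q.1; q.2] | q in setX Y Y].
have sA0 : A0 \subset A by apply/subsetP=> v; rewrite inE => /andP[].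
have cAY : #|AY| <= (#|A| - #|A0|) * 3.
  rewrite (leq_trans (leq_imset_card _ _)) // cardsX cardY leq_mul2r cardsD.
  by rewrite (setIidPr sA0) leqnn orbT.
have cYY : #|YY| <= 9 by rewrite (leq_trans (leq_imset_card _ _)) // cardsX cardY.
have cG := card_Gs.
have cover : E \subset AA :|: T1 :|: Gs :|: YY :|: AY.
  apply/subsetP=> a aE; rewrite [_ \in AA :|: _ :|: _ :|: _ :|: _]in_setU.
  rewrite [_ \in AA :|: _ :|: _ :|: _]in_setU [_ \in AA :|: _ :|: _]in_setU.
  rewrite [_ \in AA :|: _]in_setU [_ \in AA]inE aE /=.
  have [//|] := boolP (a \subset A); case/subsetPn=> u ua uA.
  have [_|a1] := boolP (a \in T1); first by [].
  have [_|aG] := boolP (a \in Gs); first by [].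
  have nP w : w \in a -> w \notin P.
    by apply: contraL => wP; move: a1; rewrite mem_T1 aE /= => /exists_inPn/(_ _ wP).
  have [v [av vu vNY ux]] : exists v, [/\ a = [set u; v], v != u, v \in N :|: Y & u != x].
    by apply: off_edgeP; rewrite mem_incident aE.
  have va : v \in a by rewrite av set22.
  have uY : u \in Y.
    by rewrite in_setC in_setU1 (negbTE ux) /=; move: uA; rewrite in_setD nP.
  move: vNY; rewrite in_setU => /orP[vN|vY]; last first.
    apply/orP; left; apply/orP; right; rewrite av.
    by apply/imsetP; exists (u, v); rewrite ?in_setX ?uY.
  apply/orP; right; rewrite av setUC; apply/imsetP; exists (v, u) => //.
  have vA : v \in A by rewrite in_setD vN nP.
  rewrite in_setX uY andbT in_setD vA andbT inE vA /=.
  apply/forallPn; exists a; rewrite negbK /low_Y mem_incident aE va aG /=.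
  by apply/exists_inP; exists u.
have cE := subset_leq_card cover.
have c5 := (leq_card_setU (AA :|: T1 :|: Gs :|: YY) AY).1.
have c4 := (leq_card_setU (AA :|: T1 :|: Gs) YY).1.
have c3 := (leq_card_setU (AA :|: T1) Gs).1; have c2 := (leq_card_setU AA T1).1.
have := cardsID lows AA; rewrite setIC.
have cA0 := subset_leq_card sA0.
move: leI cAY cYY cG cE c5 c4 c3 c2 cA0 card_T1 cardA ge_M k14.
move: #|_ :|: AY| #|_ :|: YY| #|_ :|: Gs| #|AA :|: T1| #|AY| #|YY| #|Gs| #|T1|.
move: #|lows :&: AA| #|AA :\: lows| #|AA| #|A0| #|A| #|E| #|N|.
by clear; lia.
Qed.

(** 17 = 2 + 3 * 5 pays for two forbidden sums and five labels per vertex of [P]; together with the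
    at most three edges of [Gs] it fits the 20 spaced labels. *)
Variable spare : {set {set T}}.
Hypotheses (spare_sub : spare \subset AA :\: lows) (card_spare : #|spare| = 17).
(** Edges of [Gs] meeting [P] are left out, since they carry top labels. *)
Local Notation K := (spare :|: (Gs :\: T1)).
(* The 20 spaced labels are small too, so the low edges may have to use labels up to #|lows|
   + 20. *)
Local Notation q := (#|lows| + 20).

(** The invariant of the successive corrections: it only fixes which range of labels each class of
    edges uses, so exchanges within a class preserve it. *)
Definition layered (f : {set T} -> nat) : Prop :=
  [/\ labels E f, {in K, forall a, f a \in spaced_labels #|N|},
      {in lows, forall a, f a <= q}
    & [/\ on_top E T1 f, on_top E T2 f & on_top E T3 f]].

Lemma mem_Y : [/\ y1 \in Y, y2 \in Y & y3 \in Y].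
Proof. by rewrite defY !inE !eqxx ?orbT. Qed.

Lemma Y_edge y z : y \in Y -> e y z -> [/\ [set y; z] \in E, z != x & z \in N :|: Y].
Proof.
move=> yY eyz; have [yx yN] := Y_neq yY.
have zx : z != x by apply: contraNneq yN => zx; rewrite inE e_sym -zx.
split=> //; first exact: mem_off_edges.
by rewrite in_setU in_setC in_setU1 (negbTE zx) orbN.
Qed.

Lemma mem_Gs a : a \in Gs -> a \in E /\ exists2 y, y \in Y & y \in a.
Proof.
have [Y1 Y2 Y3] := mem_Y.
rewrite in_set3 => /or3P[]/eqP->; split; rewrite ?(Y_edge Y1 e1).1.
- by have [] := Y_edge Y1 e1.
- by exists y1; rewrite ?set21.
- by have [] := Y_edge Y2 e2.
- by exists y2; rewrite ?set21.
- by have [] := Y_edge Y3 e3.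
- by exists y3; rewrite ?set21.
Qed.

Lemma mem_spare a : a \in spare ->
  [/\ a \in E, a \notin lows, a \notin T1 & {in a, forall v, v \in A}].
Proof.
move/(subsetP spare_sub); rewrite in_setD [_ \in AA]inE => /and3P[alow aE /subsetP aA].
by split=> //; apply: notin_P => v /aA vA; rewrite in_setU vA.
Qed.

(** [Gs] is disjoint from [lows] because [low_Y] excludes it and the edges of [low_A] do not meet
    [Y]. *)
Lemma mem_K a : a \in K -> [/\ a \in E, a \notin lows & a \notin T1].
Proof.
rewrite in_setU => /orP[/mem_spare[] //|/setDP[aG a1]].
have [aE [y yY ya]] := mem_Gs aG; split=> //; rewrite inE; apply/exists_inPn=> v vA.
apply/negP=> /eqP/lowP[/and3P[_]|/andP[_ /subsetP aA]]; first by rewrite aG.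
by have := A_neq_Y (aA _ ya) yY; rewrite eqxx.
Qed.

Lemma card_offT1 : #|E :\: T1| + #|T1| = #|E|.
Proof.
rewrite addnC -(cardsID T1 E) (setIidPr _) //; apply/subsetP=> a.
by rewrite mem_T1 => /andP[].
Qed.

Lemma exists_layered : exists f, layered f.
Proof.
have cG := card_Gs.
have cK : #|K| <= 20.
  rewrite (leq_trans (leq_card_setU _ _)) // card_spare leq_add2l (leq_trans _ cG) //.
  exact/subset_leq_card/subsetDl.
have c1 := card_offT1; have cT := card_T1; have cA := cardA; have cl := card_lows.
apply: (@exists_layered_labels _ E K lows T1 T2 T3 (spaced_labels #|N|) q).
- exact: subsetUl.
- exact: subsetUl.
- by apply/subsetP=> a; rewrite mem_T1 => /andP[].
- by apply/subsetP=> a /mem_K[aE _ a1]; rewrite in_setD a1.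
- by apply/subsetP=> a; apply: lows_notin_T1.
- by rewrite disjoint_subset; apply/subsetP=> a /mem_K[_ al _]; rewrite inE.
- by apply: spaced_labels_uniq; apply: leq_trans k14.
- by rewrite size_spaced_labels.
(* Spaced labels are at most 3k + 5 for k = [#|N|], while at least 3k + 31 edges lie outside
   [T1]. *)
- move=> l /spaced_labelsP[|_ -> lle]; first exact: leq_trans k14.
  apply: leq_trans lle _; move: c1 cT ge_M k14.
  by move: #|E :\: T1| #|T1| #|E| #|N|; clear; lia.
- rewrite addnC leq_add2l cK /=; move: c1 cT cA cl ge_M k14.
  by move: #|E :\: T1| #|T1| #|E| #|N| #|A| #|lows|; clear; lia.
Qed.

(** Edges with the same ends in [P] lie in the same layers among [T1], [T2], [T3]. *)
Lemma layered_tperm f g c : layered f -> g \in E -> c \in E ->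
  (g \in K) = (c \in K) -> (g \in lows) = (c \in lows) ->
  {in P, forall p, (p \in g) = (p \in c)} -> layered (f \o tperm g c).
Proof.
have [m1 m2 m3] := memP.
move=> [[fb finj] fK fq [top1 top2 top3]] gE cE gK gl gP.
have memE a : (tperm g c a \in E) = (a \in E) by rewrite mem_tperm // gE.
have memI p a : p \in P -> (tperm g c a \in incident E p) = (a \in incident E p).
  by move=> pP; rewrite mem_tperm // !mem_incident gE cE gP.
split.
- by split; [move=> a aE; apply: fb; rewrite memE | apply: tperm_injective].
- by move=> a aK; apply: fK; rewrite mem_tperm.
- by move=> a al; apply: fq; rewrite mem_tperm.
- split=> a aE /=.
  + by rewrite -top1 ?memE // !in_setU !memI.
  + by rewrite -top2 ?memE // !in_setU !memI.
  + by rewrite -top3 ?memE // !memI.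
Qed.

(** Without a low edge, every edge at [v] is in [Gs] or ends in [P]: at most 3 + 3 edges. *)
Lemma low_edge f v : layered f -> v \in A ->
  (exists a, [/\ a \in incident E v, a \notin T1 & f a <= q]) \/ D v <= 6.
Proof.
move=> [_ _ fq _] vA; case low_v: (low v) => [a|].
  left; exists a; have al : a \in lows by rewrite inE; apply/exists_inP; exists v; rewrite ?low_v.
  have := lows_notin_T1 al; rewrite in_setD => /andP[a1 _]; split; rewrite ?fq //.
  by case: (lowP low_v) => [/and3P[]|/andP[]].
right; move: low_v; rewrite /low; case: pickP => // noY; case: pickP => // noA _.
have cG := card_Gs.
have : #|incident E v :\: Gs| <= #|P|.
  apply: (@star_card_le _ v) => a /setDP[av aG].
  have [w [aE wv wNY _]] := off_edgeP av; exists w => //.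
  apply: contraT => wP; move: wNY; rewrite in_setU => /orP[wN|wY].
    have := noA a; rewrite /low_A av aE /= subUset !sub1set vA in_setD wN wP.
    by [].
  have := noY a; rewrite /low_Y av aG /=; move/exists_inPn/(_ w wY).
  by rewrite aE set22.
rewrite cardP -(cardsID Gs (incident E v)) => cD.
apply: (@leq_add _ _ 3 3) cD; apply: leq_trans cG.
exact/subset_leq_card/subsetIr.
Qed.

(** Each vertex of [P] is compared within its own layer, whose size is at most three times its
    degree by the ordering of the degrees. The only possible common edge is [[set p; v]], and the
    other edges of [v] in the layer end in the two remaining vertices of [P]. *)
Lemma layered_gap f : layered f ->
  {in P & A, forall p v, edge_sum E f v + #|N| <= edge_sum E f p}.
Proof.
move=> lay; have [[fb finj] _ _ [top1 top2 top3]] := lay.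
have [m1 m2 m3] := memP.
have gap (S : {set {set T}}) p v : S \subset T1 -> incident E p \subset S -> on_top E S f ->
    p \in P -> #|S| <= 3 * D p -> D p3 <= D p -> v \in A ->
    edge_sum E f v + #|N| <= edge_sum E f p.
  move=> S1 pS topS pP cS leD vA.
  have SE : S \subset E by apply/subsetP=> a /(subsetP S1); rewrite mem_T1 => /andP[].
  have vP : v \notin P by move: vA; rewrite in_setD => /andP[].
  (* The parameter [n] of [edge_sum_gap] is [#|N| + 4]. *)
  rewrite -[X in _ + X](addnK 4); apply: (edge_sum_gap (M := #|E|) (q := q) finj _ SE _ topS) => //.
  - by move=> a /fb/andP[].
  - exact: subset_leq_card.
  - rewrite -(cards1 v); apply: (@star_card_le _ p) => a /setIP[ap]; rewrite mem_incident.
    case/andP=> _; have [w [-> _ _ _]] := off_edgeP ap; case/set2P=> vE.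
      by rewrite vE pP in vP.
    by exists w; rewrite // vE set11.
  - have -> : 2 = #|P :\ p| by apply/eqP; rewrite -eqSS -cardP (cardsD1 p P) pP.
    apply: (@star_card_le _ v) => a /setIP[/setDP[av ap] aS].
    have [w [aE wv _ _]] := off_edgeP av; exists w => //.
    have := subsetP S1 a aS; rewrite mem_T1 => /andP[aE' /exists_inP[r rP ra]].
    have rw : r = w.
      by move: ra; rewrite aE => /set2P[rv|//]; rewrite rv (negbTE vP) in rP.
    rewrite in_setD1 -rw rP andbT; apply: contraNneq ap => <-.
    by rewrite mem_incident aE'.
  - exact: leq_trans (DA vA) leD.
  - have D8 := leq_trans D3 leD; case: (low_edge lay vA) => [[a [av a1 fa]]|D6]; last first.
      by right; apply: leq_ltn_trans D6 _; apply: leq_trans D8.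
    left; exists a; split=> //; apply: contra a1; exact: (subsetP S1).
  - by have := leq_trans D3 leD; apply: leq_trans.
  - by move: k14; clear; lia.
  - by move: ge_M; clear; lia.
  - by move: card_lows cardA; clear; lia.
have cT2 := (leq_card_setU T3 (incident E p2)).1.
have cT1 := (leq_card_setU T2 (incident E p1)).1.
have D13 := leq_trans D23 D12.
move=> p v; rewrite in_set3 => /or3P[]/eqP-> vA.
- apply: (gap T1) => //; first exact: subsetUr.
  by move: cT1 cT2 D12 D23; move: #|T1| #|T2| (D p1) (D p2) (D p3); clear; lia.
- apply: (gap T2) => //; [exact: subsetUl | exact: subsetUr |].
  by move: cT2 D23; move: #|T2| (D p2) (D p3); clear; lia.
- by apply: (gap T3) => //; [rewrite -setUA subsetUl | rewrite leq_pmull].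
Qed.

(** * Separating the vertices of [Y] from [P] and from each other *)

Lemma D_P p : p \in P -> 8 <= D p.
Proof.
by rewrite in_set3 => /or3P[]/eqP->; rewrite ?(leq_trans D3) // (leq_trans D23).
Qed.

(** It suffices that 8(M - t) + M > 5M, that is M > 2t, which holds since 2t <= 6k - 6. *)
Lemma far_bound sy sp dy dp M t k o :
  sy <= dy * M -> dp * (M - t).*2 + dp * dp.+1 <= sp.*2 -> dy <= 5 -> 8 <= dp ->
  M < o -> t + 3 <= 3 * k -> 6 * k + 28 <= M -> sy < sp + o.
Proof.
move=> le_y le_p dy5 dp8 oM tk kM.
have : dy * M <= 5 * M by rewrite leq_mul2r dy5 orbT.
have : 8 * (M - t).*2 <= dp * (M - t).*2 by rewrite leq_mul2r dp8 orbT.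
lia.
Qed.

Lemma small_degree_far f y p o : layered f -> D y <= 5 -> p \in P -> #|E| < o ->
  edge_sum E f p + o != edge_sum E f y.
Proof.
move=> [[fb finj] _ _ [top1 _ _]] D5 pP oM; rewrite gtn_eqF //.
have T1E : T1 \subset E by apply/subsetP=> a; rewrite mem_T1 => /andP[].
have pT1 : incident E p \subset T1.
  apply/subsetP=> a; rewrite mem_T1 mem_incident => /andP[-> pa].
  by apply/exists_inP; exists p.
have le_y : edge_sum E f y <= D y * #|E| by apply: edge_sum_le => a /fb/andP[].
have le_p := top_sum_ge finj T1E (subset_leq_card T1E) top1 pT1.
exact: far_bound le_y le_p D5 (D_P pP) oM card_T1 ge_M.
Qed.

(** If [g] lies inside [Y], its other end may change its sum too, hence the condition
    [u \notin g]. *)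
Definition separated f f' (y : T) (g : {set T}) (Z : seq nat) :=
  [/\ layered f',
      forall u, u \in P \/ (u \in Y /\ u \notin g) -> edge_sum E f' u = edge_sum E f u,
      edge_sum E f' y \notin Z
    & forall p o, p \in P -> #|E| < o <= #|E| + #|N| ->
        edge_sum E f' p + o != edge_sum E f' y].

(* Of the 18 spaced labels that the edge yz can take, at most 3 * 5 put y within reach of P
   and at most 2 give a value of Z. *)
Lemma separate_free f y z Z : layered f -> y \in Y -> e y z ->
  [set y; z] \in Gs -> z \notin P -> size Z <= 2 ->
  exists f', separated f f' y [set y; z] Z.
Proof.
move=> lay yY eyz gG zP szZ; have [[fb finj] fK _ _] := lay.
set g := [set y; z]; have [gE zx _] := Y_edge yY eyz.
have yP : y \notin P by apply: contraL yY => /(subsetP PN)/N_neq[].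
have gP p : p \in P -> (p \in g) = false.
  by move=> pP; apply: contraNF zP => /set2P[py|<-//]; rewrite py (negbTE yP) in pP.
have gK : g \in K.
  rewrite in_setU in_setD gG andbT mem_T1 negb_and; apply/orP; right; apply/orP; right.
  by apply/exists_inPn=> p /gP->.
have kY u c : u \in Y -> c \in spare -> u \notin c.
  move=> uY /mem_spare[_ _ _ cA]; apply/negP=> /cA uA.
  by have := A_neq_Y uA uY; rewrite eqxx.
have [|||||c [cC cZ cfar]] := @swap_avoiding_windows _ E f finj y g gE (set21 _ _)
    spare #|N| #|E| Z [seq edge_sum E f p | p <- enum P] (leq_trans _ k14).
- by [].
- by apply/subsetP=> c /mem_spare[].
- by move=> c; apply: kY.
- by move=> c; rewrite in_setU1 => /orP[/eqP->|ck]; apply: fK; rewrite ?gK // in_setU ck.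
- by rewrite size_map -cardE cardP card_spare (leq_add szZ).
have cK : c \in K by move: cC; rewrite in_setU1 => /orP[/eqP->//|ck]; rewrite in_setU ck.
have cP p : p \in P -> (p \in g) = (p \in c).
  move=> pP; rewrite gP //; apply/esym/negbTE; have [_ _] := mem_K cK.
  rewrite mem_T1 negb_and; case/orP=> [|/exists_inPn/(_ p pP)//].
  by have [-> _ _] := mem_K cK.
have [cE cl _] := mem_K cK; have [_ gl _] := mem_K gK.
have wP p : p \in P -> edge_sum E (f \o tperm g c) p = edge_sum E f p.
  by move=> pP; rewrite edge_sum_tperm ?cP.
exists (f \o tperm g c); split=> //.
- by apply: layered_tperm; rewrite ?gK ?cK ?(negbTE gl) ?(negbTE cl).
- move=> u [/wP //|[uY ug]]; rewrite edge_sum_tperm // (negbTE ug).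
  move: cC; rewrite in_setU1 => /orP[/eqP->|ck]; first by rewrite (negbTE ug).
  by rewrite (negbTE (kY u c uY ck)).
- move=> p o pP oM; rewrite wP //; apply: cfar oM.
  by apply: map_f; rewrite mem_enum.
Qed.

(* The label is exchanged with that of another edge at z, so the sum at z is unchanged; y
   has too few edges to reach P. *)
Lemma separate_forced f y z Z : layered f -> y \in Y -> e y z ->
  [set y; z] \in Gs -> z \in P -> D y <= 5 -> size Z <= 2 ->
  exists f', separated f f' y [set y; z] Z.
Proof.
move=> lay yY eyz gG zP D5 szZ; have [[fb finj] fK _ _] := lay.
set g := [set y; z]; have [gE zx _] := Y_edge yY eyz.
have YP u : u \in Y -> u \notin P by apply: contraL => /(subsetP PN)/N_neq[].
pose C := [set a in incident E z | [exists v in A, v \in a]].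
have memC c : c \in C -> exists2 v, v \in A & c = [set z; v].
  rewrite inE => /andP[cz /exists_inP[v vA vc]]; exists v => //.
  have [w [cE _ _ _]] := off_edgeP cz; move: vc; rewrite cE => /set2P[vz|->//].
  by rewrite vz in_setD zP in vA.
have CE : C \subset E by apply/subsetP=> c; rewrite inE mem_incident => /andP[/andP[]].
have CY u c : u \in Y -> c \in C -> u \notin c.
  move=> uY /memC[v vA ->]; rewrite !inE negb_or; apply/andP; split.
    by apply: contraNneq (YP u uY) => ->.
  by rewrite eq_sym A_neq_Y.
have leC : size Z <= #|C|.
  (* Edges at [z] outside [C] end in [P :\ z] or [Y]: at most 2 + 3 of at least 8, so three
     remain. *)
  apply: leq_trans szZ _; have : #|incident E z :\: C| <= #|(P :\ z) :|: Y|.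
    apply: (@star_card_le _ z) => a /setDP[az]; rewrite inE az /= => /exists_inPn aA.
    have [w [aE wz wNY _]] := off_edgeP az; exists w => //.
    apply: contraT; rewrite in_setU negb_or in_setD1 wz /= => /andP[wP wY].
    move: wNY; rewrite in_setU (negbTE wY) orbF => wN.
    by have := aA w; rewrite in_setD wP wN aE set22 => /(_ isT).
  have CI : C \subset incident E z by apply/subsetP=> c; rewrite inE => /andP[].
  have := D_P zP; rewrite -(cardsID C (incident E z)) (setIidPr CI).
  have := (leq_card_setU (P :\ z) Y).1; rewrite cardY.
  have := cardsD1 z P; rewrite cardP zP.
  by move: #|C| #|_ :\: C| #|P :\ z| #|_ :|: _|; clear; lia.
have [c cC cZ] := @swap_avoiding _ E f finj y g gE (set21 _ _) C Z CE (CY y ^~ yY) leC.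
have cE : c \in E.
  by move: cC; rewrite in_setU1 => /orP[/eqP->//|]; apply: (subsetP CE).
have cP p : p \in P -> (p \in g) = (p \in c).
  move=> pP; move: cC; rewrite in_setU1 => /orP[/eqP->//|/memC[v vA ->]].
  have pv : p == v = false by apply: contraTF vA => /eqP<-; rewrite in_setD pP.
  have py : p == y = false by apply: contraTF yY => /eqP<-; apply: contraL pP; apply: YP.
  by rewrite !inE pv py orbF.
have zE (a : {set T}) : z \in a -> a \in E -> a \in T1.
  by move=> za aE; rewrite mem_T1 aE; apply/exists_inP; exists z.
have zc : z \in c by rewrite -cP ?set22.
(* Both exchanged edges contain [z], so they lie in [T1] and the conditions on [K] and [lows] are
   not affected. *)
have out (a : {set T}) : a \in T1 -> (a \in K) = false /\ (a \in lows) = false.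
  move=> a1; split; apply/negbTE.
    by apply/negP=> /mem_K[_ _]; rewrite a1.
  by apply/negP=> /lows_notin_T1; rewrite in_setD a1.
have [gK gl] := out g (zE g (set22 _ _) gE); have [cK cl] := out c (zE c zc cE).
exists (f \o tperm g c); split=> //.
- by apply: layered_tperm; rewrite ?gK ?cK ?gl ?cl.
- move=> u [uP|[uY ug]]; rewrite edge_sum_tperm //; first exact: cP.
  rewrite (negbTE ug).
  move: cC; rewrite in_setU1 => /orP[/eqP->|ck]; first by rewrite (negbTE ug).
  by rewrite (negbTE (CY u c uY ck)).
- move=> p o pP /andP[oM _]; apply: small_degree_far => //.
  by apply: layered_tperm; rewrite ?gK ?cK ?gl ?cl.
Qed.

(** The vertices are corrected in the order [y1], [y2], [y3], and a later exchange must not touch a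
    vertex already settled. *)
Hypotheses (z2y1 : z2 != y1) (z3y1 : z3 != y1) (z3y2 : z3 != y2).
Hypotheses (D1 : z1 \in P -> D y1 <= 5) (D2 : z2 \in P -> D y2 <= 5).
Hypothesis D3' : z3 \in P -> D y3 <= 5.

Lemma separate f y z Z : layered f -> y \in Y -> e y z ->
  [set y; z] \in Gs -> (z \in P -> D y <= 5) -> size Z <= 2 ->
  exists f', separated f f' y [set y; z] Z.
Proof.
move=> lay yY eyz gG DP szZ; have [zP|zP] := boolP (z \in P).
  by apply: separate_forced => //; apply: DP.
exact: separate_free.
Qed.

(** Each correction avoids the sums of the settled vertices of [Y]. It changes neither these sums
    nor those on [P], so the separation from [P] obtained earlier persists. *)
Lemma core_antimagic : antimagic e.
Proof.
have [Y1 Y2 Y3] := mem_Y.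
have [y21 y31 y32] : [/\ y2 != y1, y3 != y1 & y3 != y2].
  move: cardY; rewrite defY -setUA cardsU1 cards2 !inE (eq_sym y1 y2) (eq_sym y1 y3).
  by rewrite (eq_sym y2 y3); case: (y2 == y1) (y3 == y1) (y3 == y2) => [] [] [].
have [f0 lay0] := exists_layered.
have [|f1 [lay1 _ _ far1]] := separate lay0 Y1 e1 _ D1 (isT : size [::] <= 2).
  by rewrite in_set3 eqxx.
have [|f2 [lay2 same2 new2 far2]] :=
    separate lay1 Y2 e2 _ D2 (isT : size [:: edge_sum E f1 y1] <= 2).
  by rewrite in_set3 eqxx orbT.
have [|f3 [lay3 same3 new3 far3]] := separate lay2 Y3 e3 _ D3'
    (isT : size [:: edge_sum E f2 y1; edge_sum E f2 y2] <= 2).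
  by rewrite in_set3 eqxx !orbT.
have eq21 : edge_sum E f2 y1 = edge_sum E f1 y1.
  by apply: same2; right; split=> //; rewrite !inE negb_or (eq_sym y1) y21 (eq_sym y1).
have eq31 : edge_sum E f3 y1 = edge_sum E f2 y1.
  by apply: same3; right; split=> //; rewrite !inE negb_or (eq_sym y1) y31 (eq_sym y1).
have eq32 : edge_sum E f3 y2 = edge_sum E f2 y2.
  by apply: same3; right; split=> //; rewrite !inE negb_or (eq_sym y2) y32 (eq_sym y2).
have [[fb finj] _ _ _] := lay3.
apply: (@star_completion _ e e_sym e_irr x P f3) => //.
- exact: leq_trans k14.
- by rewrite cardY cardP.
- rewrite -eq31 -eq32 in_cons mem_seq1 negb_or in new3; case/andP: new3 => n31 n32.
  rewrite -eq32 -eq21 -eq31 mem_seq1 in new2.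
  move=> u v; rewrite {1 2}defY !in_set3 => /or3P[]/eqP-> /or3P[]/eqP-> // /eqP.
  + by rewrite eq_sym (negbTE new2).
  + by rewrite eq_sym (negbTE n31).
  + by rewrite (negbTE new2).
  + by rewrite eq_sym (negbTE n32).
  + by rewrite (negbTE n31).
  + by rewrite (negbTE n32).
- exact: layered_gap.
- move=> p y pP; rewrite {1}defY in_set3 => /or3P[]/eqP-> o oM.
  + rewrite eq31 eq21 same3; last by left.
    by rewrite same2; [apply: far1 | left].
  + by rewrite eq32 same3; [apply: far2 | left].
  + exact: far3.
Qed.
End Core.

(** * Choosing the vertices *)

Lemma exists_max (T : finType) (D : T -> nat) (S : {set T}) :
  0 < #|S| -> exists2 p, p \in S & {in S, forall v, D v <= D p}.
Proof.
case/card_gt0P=> p0 p0S; case: (arg_maxnP D p0S) => p pS maxp.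
by exists p => // v; apply: maxp.
Qed.

(** Peeling by connectivity: [y3] has a neighbour outside [Y], then [y2] has one outside [Y :\ y3],
    then [y1] one outside the remaining singleton. *)
Lemma three_exits (T : finType) (e : rel T) (Y : {set T}) x :
  connected_graph e -> #|Y| = 3 -> x \notin Y ->
  exists y1 y2 y3 z1 z2 z3, [/\ Y = [set y1; y2; y3], e y1 z1, e y2 z2 & e y3 z3]
    /\ [/\ z2 != y1, z3 != y1 & z3 != y2].
Proof.
move=> e_conn cY xY.
have exit (S : {set T}) n : S \subset Y -> #|S| = n.+1 ->
    exists s t, [/\ s \in S, t \notin S, e s t & #|S :\ s| = n].
  move=> SY cS; have /card_gt0P[s0 s0S] : 0 < #|S| by rewrite cS.
  have xS : x \notin S by apply: contra xY; apply: subsetP.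
  have [s [t [sS tS est]]] := connected_exit e_conn s0S xS.
  by exists s, t; split=> //; apply/eqP; rewrite -eqSS -cS (cardsD1 s S) sS.
have [y3 [z3 [y3S z3S e3 c2]]] := exit Y 2 (subxx _) cY.
have S2Y : Y :\ y3 \subset Y := subsetDl _ _.
have [y2 [z2 [y2S z2S e2 c1]]] := exit _ 1 S2Y c2.
have S1Y : Y :\ y3 :\ y2 \subset Y := subset_trans (subsetDl _ _) S2Y.
have [y1 [z1 [y1S _ e1 c0]]] := exit _ 0 S1Y c1.
have y1Y2 : y1 \in Y :\ y3 by move: y1S => /setD1P[].
have y1Y : y1 \in Y by apply: (subsetP S2Y).
have y2Y : y2 \in Y by apply: (subsetP S2Y).
exists y1, y2, y3, z1, z2, z3; do !split=> //.
- apply/eqP; rewrite eq_sym eqEcard cY; apply/andP; split.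
    by apply/subsetP=> u; rewrite in_set3 => /or3P[]/eqP->.
  move: y1S y2S; rewrite !in_setD1 => /and3P[y12 y13 _] /andP[y23 _].
  by rewrite -setUA cardsU1 cards2 !inE negb_or y12 y13 y23.
- by apply: contraNneq z2S => ->.
- by apply: contraNneq z3S => ->.
- by apply: contraNneq z3S => ->.
Qed.

Section Choices.
Variables (T : finType) (e : rel T).
Hypotheses (e_sym : symmetric e) (e_irr : irreflexive e).
Variable x : T.
Local Notation E := (off_edges e x).
Local Notation N := (nbhd e x).
Local Notation Y := (~: (x |: nbhd e x)).
Local Notation D u := #|incident E u|.
Hypotheses (cardY : #|Y| = 3) (degE : forall u, degree e u <= #|N|).

(** A neighbour in [N :\: P] is preferred. If there is none, all neighbours of [y] lie in [P] or in
    [Y :\ y], at most 3 + 2 vertices. *)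
Lemma exists_neighbour (P : {set T}) y z :
  P \subset N -> #|P| = 3 -> y \in Y -> e y z ->
  exists z', [/\ e y z', z' = z \/ z' \in N & z' \in P -> D y <= 5].
Proof.
move=> PN cP yY eyz; have [/exists_inP[w wA eyw]|noA] := boolP [exists w in N :\: P, e y w].
  exists w; move: wA; rewrite in_setD => /andP[wP wN].
  by split=> //; [right | rewrite (negbTE wP)].
exists z; split=> // [|_]; first by left.
have -> : 5 = #|P| + #|Y :\ y|.
  by have := cardsD1 y Y; rewrite cardY yY cP; clear; lia.
apply: leq_trans (leq_card_setU _ _).1; apply: (@star_card_le _ y) => a ay.
have [w [aE wy wNY _]] := off_edgeP e_sym e_irr ay; exists w => //.
move: wNY; rewrite !in_setU in_setD1 wy => /orP[wN|->]; last by rewrite orbT.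
apply/orP; left; apply: contraR noA => wP; apply/exists_inP; exists w.
  by rewrite in_setD wP.
have : a \in incident (edges e) y.
  by move: ay; rewrite !mem_incident inE -andbA => /and3P[-> _ ->].
case/(incident_edgesP _ _ e_sym) => v eyv; rewrite aE => /(set2_inj wy).
by move->.
Qed.

Lemma sum_off_degrees : 2 * #|E| = \sum_(u in N) D u + \sum_(u in Y) D u.
Proof.
rewrite -sum_card_incident; last by move=> a; rewrite inE => /andP[/(card_mem_edges e_irr)].
rewrite (bigID (mem N)) /= addnC (bigD1 x) ?x_notin_nbhd //= addnC; congr (_ + _).
have -> : D x = 0 by apply: eq_card0 => a; rewrite !inE -andbA; case: (x \in a); rewrite !andbF.
by apply: eq_bigl => u; rewrite in_setC in_setU1 negb_or andbC.
Qed.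

Lemma exists_large_triple : 14 <= #|N| -> 6 * #|N| + 28 <= #|E| ->
  exists p1 p2 p3, [/\ [set p1; p2; p3] \subset N, #|[set p1; p2; p3]| = 3,
    D p2 <= D p1, D p3 <= D p2 & 8 <= D p3] /\
    {in N :\: [set p1; p2; p3], forall v, D v <= D p3}.
Proof.
move=> k14 ge_M; pose k := #|N|.
have [|p1 p1N max1] := @exists_max _ (fun u => D u) N; first exact: leq_trans k14.
have c1 : #|N :\ p1| = k.-1 by rewrite /k (cardsD1 p1 N) p1N.
have [|p2 p2N max2] := @exists_max _ (fun u => D u) (N :\ p1).
  by rewrite c1 -subn1 subn_gt0 (leq_trans _ k14).
have c2 : #|N :\ p1 :\ p2| = k.-2 by rewrite -c1 (cardsD1 p2 (N :\ p1)) p2N.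
have [|p3 p3N max3] := @exists_max _ (fun u => D u) (N :\ p1 :\ p2).
  by rewrite c2 -subn2 subn_gt0 (leq_trans _ k14).
have p3N1 : p3 \in N :\ p1 by move: p3N => /setD1P[].
have p3N0 : p3 \in N by move: p3N1 => /setD1P[].
have p2N0 : p2 \in N by move: p2N => /setD1P[].
have D_lt u : u \in N -> D u < k.
  move=> uN; have ux : u != x by apply: contraTneq uN => ->; rewrite x_notin_nbhd.
  by have := degE u; rewrite (card_incident_off e_sym e_irr ux) uN addn1.
have sumY : \sum_(u in Y) D u <= 3 * k.
  rewrite -cardY -sum_nat_const; apply: leq_sum => u; rewrite in_setC in_setU1 negb_or.
  case/andP=> ux uN; have := degE u.
  by rewrite (card_incident_off e_sym e_irr ux) (negbTE uN) addn0.
have sumN : \sum_(u in N) D u <= D p1 + (D p2 + k.-2 * D p3).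
  rewrite (big_setD1 p1 p1N) leq_add2l (big_setD1 p2 p2N) leq_add2l.
  by rewrite -c2 -sum_nat_const; apply: leq_sum => u; apply: max3.
exists p1, p2, p3; do !split.
- by apply/subsetP=> u; rewrite in_set3 => /or3P[]/eqP->.
- move: p2N p3N; rewrite !in_setD1 => /andP[p21 _] /and3P[p32 p31 _].
  by rewrite -setUA cardsU1 cards2 !inE negb_or ![p1 == _]eq_sym p21 p31 eq_sym p32.
- exact: max1.
- exact: max2.
(* Otherwise the degree sum is at most 2(k - 1) + 7(k - 2) + 3k = 12k - 16, below 2(6k + 28). *)
- rewrite ltnNge; apply/negP=> D7.
  have : k.-2 * D p3 <= k.-2 * 7 by rewrite leq_mul2l D7 orbT.
  move: sum_off_degrees sumN sumY (D_lt _ p1N) (D_lt _ p2N0) k14 ge_M; rewrite -/k.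
  move: (\sum_(u in N) _) (\sum_(u in Y) _) (D p1) (D p2) (k.-2 * _) #|E|.
  by clear; lia.
- move=> v; rewrite in_setD in_set3 !negb_or => /andP[/and3P[v1 v2 _] vN].
  by apply: max3; rewrite !in_setD1 v1 v2.
Qed.
End Choices.

Theorem theorem5 (T : finType) (e : rel T)
    (e_sym : symmetric e) (e_irr : irreflexive e)
    (e_conn : connected_graph e)
    (max_deg : max_degree e + 4 = #|T|)
    (many_edges : 7 * #|T| <= #|edges e|) :
  antimagic e.
Proof.
have T_gt0 : 0 < #|T| by rewrite -max_deg addn4.
have [x max_x] := eq_bigmax (degree e) T_gt0.
have degE u : degree e u <= #|nbhd e x|.
  by rewrite -/(degree e x) -max_x; apply: (leq_bigmax u).
have cT : #|nbhd e x| + 4 = #|T| by rewrite -/(degree e x) -max_x.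
have xN := x_notin_nbhd e_irr x.
have cY : #|~: (x |: nbhd e x)| = 3.
  have := cardsC (x |: nbhd e x); rewrite cardsU1 xN -cT; lia.
have cE := card_edges_star e_sym e_irr x.
(* With k the degree of [x], this is 7(k + 4) - k. *)
have ge_M : 6 * #|nbhd e x| + 28 <= #|off_edges e x|.
  by move: many_edges; rewrite cE -cT; move: #|nbhd e x| #|off_edges e x|; clear; lia.
(* Handshake: 14n <= 2m <= nk, where n = [#|T|], m = [#|edges e|] and k is the degree of [x]. *)
have k14 : 14 <= #|nbhd e x|.
  have : \sum_u degree e u <= #|T| * #|nbhd e x|.
    by rewrite -sum_nat_const; apply: leq_sum => u _.
  under eq_bigr do rewrite degreeE //.
  rewrite sum_card_incident; last by move=> a; apply: card_mem_edges.
  move: many_edges; rewrite -cT; move: #|nbhd e x| #|edges e| => k m; clear; nia.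
have [p1 [p2 [p3 [[PN cP D12 D23 D3] DA]]]] := exists_large_triple e_sym e_irr cY degE k14 ge_M.
have xY : x \notin ~: (x |: nbhd e x) by rewrite in_setC setU11.
have [y1 [y2 [y3 [u1 [u2 [u3 [[defY f1 f2 f3] [u21 u31 u32]]]]]]]] := three_exits e_conn cY xY.
have [Y1 Y2 Y3] : [/\ y1 \in ~: (x |: nbhd e x), y2 \in ~: (x |: nbhd e x)
    & y3 \in ~: (x |: nbhd e x)] by rewrite defY !inE !eqxx ?orbT.
(* Replacing an exit by a vertex of [N] keeps it distinct from all of [Y]. *)
have neY u z y : z = u \/ z \in nbhd e x -> u != y -> y \in ~: (x |: nbhd e x) -> z != y.
  move=> [->//|zN] _; rewrite in_setC in_setU1 negb_or => /andP[_].
  by apply: contraNneq => <-.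
have [z1 [e1 _ D1]] := exists_neighbour e_sym e_irr cY PN cP Y1 f1.
have [z2 [e2 zu2 D2]] := exists_neighbour e_sym e_irr cY PN cP Y2 f2.
have [z3 [e3 zu3 D3']] := exists_neighbour e_sym e_irr cY PN cP Y3 f3.
have [spare spareS cspare] := exists_subset_card
  (card_AA_lows e_sym e_irr PN cP cY degE k14 ge_M y1 y2 y3 z1 z2 z3).
apply: (core_antimagic e_sym e_irr PN cP cY degE k14 ge_M D12 D23 D3 DA defY e1 e2 e3
  spareS cspare) => //.
- exact: neY zu2 u21 Y1.
- exact: neY zu3 u31 Y1.
- exact: neY zu3 u32 Y2.
Qed.
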